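(* Let $E$ be an infinite extremally disconnected compact Hausdorff space, let $p\ne q$ be non-isolated points of $E$, let $\gamma:E\to\dot{E}_\gamma$ be the quotient map identifying just $p$ and $q$, and let $a(\gamma)$ be the associated covering operator. (i) $\mathcal{V}(C(E),\mu(a(\gamma)))$ has minimum $F(\dot{E}_\gamma)$. (ii) If $Y$ is a compact Hausdorff space homeomorphic to neither $\dot{E}_\gamma$ nor $E$, then $\mathcal{V}(C(Y),\mu(a(\gamma)))$ has a minimum if and only if $Y$ is zero-dimensional, and in that case the minimum is $F(Y)$.
   Context: For compact Hausdorff spaces $X,Z$, a continuous surjection $f:Z\to X$ is a covering map if $f(F)\neq X$ for every proper closed $F\subset Z$; then $(Z,f)$ is a cover of $X$. $\dot{E}_\gamma$ is the quotient of $E$ identifying just $p$ and $q$; $\gamma$ is a covering map. The covering operator $a(\gamma)$ assigns to each compact Hausdorff $X$ the cover $(a(\gamma)X,a(\gamma)_X)$ of $X$ given by $(E,\gamma)$ if $X=\dot{E}_\gamma$, and by $(X,\mathrm{id}_X)$ if $X\neq\dot{E}_\gamma$, where $=$ between spaces means homeomorphic (homeomorphic spaces are identified). $\mathbf{W}^*$ is the category of Archimedean vector lattices with distinguished strong unit and unit-preserving vector lattice homomorphisms. For compact Hausdorff $X$, $C(X)\in\mathbf{W}^*$ is the vector lattice of continuous real-valued functions on $X$ with unit the constant function $1$; $F(X)=\{f\in C(X): f(X)\text{ is finite}\}$. An injective morphism $f:A\to B$ is essential if for every $0<b\in B$ there are $0<a\in A$ and $n\in\mathbb{N}$ with $f(a)\le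 nb$. For $A\in\mathbf{W}^*$ with unit $u$, the Yosida space $YA$ is the compact Hausdorff space of ideals of $A$ maximal with respect to not containing $u$, with the hull-kernel topology; there is an injective morphism $\nu_A:A\to C(YA)$ whose image separates points, and $(YA,\nu_A)$ is unique up to homeomorphism with this property. For a covering operator $c$, $\mu(c)$ is the hull operator on $\mathbf{W}^*$ given by $\mu(c)A=C(cYA)$ with essential embedding $\mu(c)_A:A\to C(cYA)$, $\mu(c)_A(a)=\nu_A(a)\circ c_{YA}$. For $H\in\mathbf{W}^*$ with $\mu(c)H=H$ (i.e. $\mu(c)_H$ is an isomorphism), $\mathcal{V}(H,\mu(c))=\{A\in\mathbf{W}^*:\mu(c)A=H\}$, where $A$ is identified with the pair $(A,\mu(c)_A)$, $\mu(c)_A:A\to\mu(c)A=H$ (in (i), $YA$ is $\dot{E}_\gamma$ or $E$, and $\mu(a(\gamma))_A$ is $a\mapsto\nu_A(a)\circ\gamma$ or $\nu_A$, respectively). Order: $A_1\le A_2$ iff there is an essential embedding $f:A_1\to A_2$ with $\mu(c)_{A_1}=\mu(c)_{A_2}\circ f$; objects that are $\le$ each other are identified. *)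

(* Defs.v *)
From HB Require Import structures.
From mathcomp Require Import all_boot all_order all_algebra generic_quotient.
From mathcomp Require Import all_classical all_reals all_analysis.
Set Implicit Arguments.
Unset Strict Implicit.
Unset Printing Implicit Defensive.
Import Order.TTheory GRing.Theory Num.Theory.
Import numFieldNormedType.Exports.

Local Open Scope classical_set_scope.
Local Open Scope ring_scope.

(* Objects of W*: Archimedean vector lattices with a distinguished strong     *)
(* unit. The zero lattice, with unit 0, is an object: it is C(X) for X empty. *)

HB.mixin Record isVectorLattice (R : realType) A
    of GRing.Lmodule R A & Num.POrderedZmodule A := {
  vjoin : A -> A -> A ;
  vmeet : A -> A -> A ;
  vjoin_le : forall x y z : A, (vjoin x y <= z) = (x <= z) && (y <= z) ;
  le_vmeet : forall x y z : A, (z <= vmeet x y) = (z <= x) && (z <= y) ;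
  vlat_leD2r : forall x y z : A, x <= y -> x + z <= y + z ;
  vlat_scale_ge0 : forall (c : R) (x : A), 0 <= c -> 0 <= x -> 0 <= c *: x }.

#[short(type="vectorLatticeType")]
HB.structure Definition VectorLattice (R : realType) :=
  {A of GRing.Lmodule R A & Num.POrderedZmodule A & isVectorLattice R A}.

Definition vabs (R : realType) (A : vectorLatticeType R) (x : A) : A :=
  vjoin x (- x).

HB.mixin Record isWstar (R : realType) A of VectorLattice R A := {
  wunit : A ;
  vlat_archimedean : forall x y : A,
    0 <= x -> (forall n : nat, x *+ n <= y) -> x = 0 ;
  wunit_ge0 : 0 <= wunit ;
  wunit_strong : forall x : A, exists n : nat, vabs x <= wunit *+ n }.

#[short(type="wstarType")]
HB.structure Definition Wstar (R : realType) :=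
  {A of VectorLattice R A & isWstar R A}.

Section morphisms.
Context (R : realType) (A B : wstarType R).

Definition wstar_hom (f : A -> B) : Prop :=
  [/\ linear f,
      forall x y, f (vjoin x y) = vjoin (f x) (f y),
      forall x y, f (vmeet x y) = vmeet (f x) (f y)
    & f wunit = wunit].

Definition essential_embedding (f : A -> B) : Prop :=
  [/\ wstar_hom f, injective f
    & forall b : B, 0 < b ->
        exists (a : A) (n : nat), 0 < a /\ f a <= b *+ n].

End morphisms.

(* A type T whose elements are determined by bounded functions on X, closed   *)
(* under the pointwise operations, is an object of W*.                        *)
HB.factory Record FunLattice_isWstar (R : realType) T of Choice T := {
  fl_dom : Type ;
  fl_ev : T -> fl_dom -> R ;
  fl_inj : forall f g : T, fl_ev f =1 fl_ev g -> f = g ;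
  fl_one : T ;
  fl_zero : T ;
  fl_opp : T -> T ;
  fl_add : T -> T -> T ;
  fl_scale : R -> T -> T ;
  fl_max : T -> T -> T ;
  fl_min : T -> T -> T ;
  fl_oneE : forall x, fl_ev fl_one x = 1 ;
  fl_zeroE : forall x, fl_ev fl_zero x = 0 ;
  fl_oppE : forall f x, fl_ev (fl_opp f) x = - fl_ev f x ;
  fl_addE : forall f g x, fl_ev (fl_add f g) x = fl_ev f x + fl_ev g x ;
  fl_scaleE : forall c f x, fl_ev (fl_scale c f) x = c * fl_ev f x ;
  fl_maxE : forall f g x,
    fl_ev (fl_max f g) x = Num.max (fl_ev f x) (fl_ev g x) ;
  fl_minE : forall f g x,
    fl_ev (fl_min f g) x = Num.min (fl_ev f x) (fl_ev g x) ;
  fl_bounded : forall f, exists M : R, forall x, fl_ev f x <= M }.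

HB.builders Context R T of FunLattice_isWstar R T.

Notation ev := fl_ev.
Let le (f g : T) : bool := `[< forall x, ev f x <= ev g x >].
Let lin_meetE :=
  (fl_zeroE, fl_oppE, fl_addE, fl_scaleE, fl_maxE, fl_minE).

Let addA : associative fl_add.
Proof. by move=> f g h; apply: fl_inj => x; rewrite !lin_meetE addrA. Qed.
Let addC : commutative fl_add.
Proof. by move=> f g; apply: fl_inj => x; rewrite !lin_meetE addrC. Qed.
Let add0 : left_id fl_zero fl_add.
Proof. by move=> f; apply: fl_inj => x; rewrite !lin_meetE add0r. Qed.
Let addN : left_inverse fl_zero fl_opp fl_add.
Proof. by move=> f; apply: fl_inj => x; rewrite !lin_meetE addNr. Qed.
HB.instance Definition _ := GRing.isZmodule.Build T addA addC add0 addN.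

Let scaleA (a b : R) (v : T) : fl_scale a (fl_scale b v) = fl_scale (a * b) v.
Proof. by apply: fl_inj => x; rewrite !lin_meetE mulrA. Qed.
Let scale1 : left_id 1 fl_scale.
Proof. by move=> v; apply: fl_inj => x; rewrite !lin_meetE mul1r. Qed.
Let scaleDr : right_distributive fl_scale +%R.
Proof. by move=> a u v; apply: fl_inj => x; rewrite !lin_meetE mulrDr. Qed.
Let scaleDl (v : T) : {morph fl_scale^~ v : a b / a + b}.
Proof. by move=> a b; apply: fl_inj => x; rewrite !lin_meetE mulrDl. Qed.
HB.instance Definition _ :=
  GRing.Zmodule_isLmodule.Build R T scaleA scale1 scaleDr scaleDl.

Let leP f g : reflect (forall x, ev f x <= ev g x) (le f g).
Proof. exact: asboolP. Qed.
Let fl_le_refl : reflexive le.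
Proof. by move=> f; apply/leP. Qed.
Let fl_le_anti : antisymmetric le.
Proof.
move=> f g /andP[/leP fg /leP gf].
by apply: fl_inj => x; apply/eqP; rewrite eq_le fg gf.
Qed.
Let fl_le_trans : transitive le.
Proof.
move=> g f h /leP fg /leP gh; apply/leP => x.
exact: le_trans (fg x) (gh x).
Qed.
HB.instance Definition _ :=
  Order.Le_isPOrder.Build ring_display T fl_le_refl fl_le_anti fl_le_trans.

Let lexI g h f : le f (fl_min g h) = le f g && le f h.
Proof.
apply/leP/andP => [fgh|[/leP fg /leP fh] x].
  by split; apply/leP => x; have := fgh x; rewrite fl_minE le_min => /andP[].
by rewrite fl_minE le_min fg fh.
Qed.
Let leUx f g h : le (fl_max f g) h = le f h && le g h.
Proof.
apply/leP/andP => [fgh|[/leP fg /leP fh] x].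
  by split; apply/leP => x; have := fgh x; rewrite fl_maxE ge_max => /andP[].
by rewrite fl_maxE ge_max fg fh.
Qed.
Let leD2r (f g h : T) : f <= g -> f + h <= g + h.
Proof. by move=> /leP fg; apply/leP => x; rewrite !fl_addE lerD2r. Qed.
Let scale_ge0 (c : R) (f : T) : 0 <= c -> 0 <= f -> 0 <= c *: f.
Proof.
move=> c0 /leP f0; apply/leP => x; rewrite fl_scaleE fl_zeroE mulr_ge0//.
by have := f0 x; rewrite fl_zeroE.
Qed.
HB.instance Definition _ := isVectorLattice.Build R T leUx lexI leD2r scale_ge0.

Let mulrnE (f : T) n x : ev (f *+ n) x = ev f x *+ n.
Proof.
elim: n => [|n ih]; first by rewrite !mulr0n fl_zeroE.
by rewrite !mulrS fl_addE ih.
Qed.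
Let archimedean (f g : T) : 0 <= f -> (forall n, f *+ n <= g) -> f = 0.
Proof.
move=> /leP f0 fg; apply: fl_inj => x; rewrite fl_zeroE.
have : 0 <= ev f x by have := f0 x; rewrite fl_zeroE.
rewrite le_eqVlt => /predU1P[<-//|fx0].
have [n] : exists n : nat, ev g x / ev f x < n%:R.
  exists (Num.bound `|ev g x / ev f x|).
  by apply: le_lt_trans (ler_norm _) _; exact: archi_boundP (normr_ge0 _).
rewrite ltr_pdivrMr// mulr_natl => gn.
by have /leP/(_ x) := fg n; rewrite mulrnE leNgt gn.
Qed.
Let one_ge0 : (0 : T) <= fl_one.
Proof. by apply/leP => x; rewrite fl_zeroE fl_oneE. Qed.
Let one_strong (f : T) : exists n : nat, vabs f <= fl_one *+ n.
Proof.
have [M fM] := fl_bounded (fl_max f (fl_opp f)).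
exists (Num.bound `|M|); apply/leP => x; rewrite mulrnE fl_oneE.
apply: le_trans (fM x) _.
apply: le_trans (ler_norm _) _.
by apply: ltW; exact: archi_boundP (normr_ge0 _).
Qed.
HB.instance Definition _ := isWstar.Build R T archimedean one_ge0 one_strong.

HB.end.

HB.mixin Record isCompactHausdorff T of Topological T := {
  ch_compact : compact [set: T] ;
  ch_hausdorff : hausdorff_space T }.

#[short(type="compHausType")]
HB.structure Definition CompactHausdorff :=
  {T of Topological T & isCompactHausdorff T}.

Section contfun.
Context (R : realType) (X : topologicalType).
Implicit Types f g : continuousType X R.

Lemma cont_opp f : continuous (fun x => - f x).
Proof. by move=> x; apply: (@cvgN R R^o); exact: cts_fun. Qed.

Lemma cont_add f g : continuous (fun x => f x + g x).
Proof. by move=> x; apply: (@cvgD R R^o); exact: cts_fun. Qed.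

Lemma cont_scale (c : R) f : continuous (fun x => c * f x).
Proof. by move=> x; apply: cvgM; [exact: cvg_cst|exact: cts_fun]. Qed.

Lemma cont_max f g : continuous (f \max g).
Proof. by move=> x; apply: (@continuous_max R); exact: cts_fun. Qed.

Lemma cont_min f g : continuous (f \min g).
Proof. by move=> x; apply: (@continuous_min R); exact: cts_fun. Qed.

Lemma compact_range_bounded (f : X -> R) :
  compact (range f) -> exists M : R, forall x, f x <= M.
Proof.
move=> /(@compact_bounded R R^o)[M [_ /(_ (M + 1))]].
rewrite ltrDl ltr01 => /(_ isT) fM; exists (M + 1) => x.
by apply: le_trans (ler_norm _) (fM _ _); exists x.
Qed.

End contfun.

Definition contW (R : realType) (X : topologicalType) : Type :=
  continuousType X R.
HB.instance Definition _ R X := Choice.on (contW R X).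

Section C_wstar.
Context (R : realType) (X : compHausType).

Let C_inj (f g : contW R X) : (f : X -> R) =1 g -> f = g.
Proof. by move/continuousEP. Qed.

Let C_bounded (f : contW R X) : exists M : R, forall x, f x <= M.
Proof.
apply: compact_range_bounded.
apply: continuous_compact; last exact: ch_compact.
by apply: continuous_subspaceT; exact: cts_fun.
Qed.

Let C_one : contW R X := cst 1.
Let C_zero : contW R X := cst 0.
Let C_opp (f : contW R X) : contW R X :=
  mkcts (@cont_opp R X f).
Let C_add (f g : contW R X) : contW R X :=
  mkcts (@cont_add R X f g).
Let C_scale (c : R) (f : contW R X) : contW R X :=
  mkcts (@cont_scale R X c f).
Let C_max (f g : contW R X) : contW R X :=
  mkcts (@cont_max R X f g).
Let C_min (f g : contW R X) : contW R X :=
  mkcts (@cont_min R X f g).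
Let C_oneE x : C_one x = 1. Proof. by []. Qed.
Let C_zeroE x : C_zero x = 0. Proof. by []. Qed.
Let C_oppE f x : C_opp f x = - f x. Proof. by []. Qed.
Let C_addE f g x : C_add f g x = f x + g x. Proof. by []. Qed.
Let C_scaleE c f x : C_scale c f x = c * f x. Proof. by []. Qed.
Let C_maxE f g x : C_max f g x = Num.max (f x) (g x). Proof. by []. Qed.
Let C_minE f g x : C_min f g x = Num.min (f x) (g x). Proof. by []. Qed.

HB.instance Definition _ := FunLattice_isWstar.Build R (contW R X) C_inj
  C_oneE C_zeroE C_oppE C_addE C_scaleE C_maxE C_minE C_bounded.

End C_wstar.

Section contWE.
Context (R : realType) (X : compHausType).
Implicit Types f g : contW R X.

Lemma contW_leP f g : (f <= g) <-> forall x, f x <= g x.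
Proof. by split=> [/asboolP//|h]; exact/asboolP. Qed.

Lemma contW_unitE x : (wunit : contW R X) x = 1. Proof. by []. Qed.

Lemma contW_joinE f g x : vjoin f g x = Num.max (f x) (g x). Proof. by []. Qed.

Lemma contW_meetE f g x : vmeet f g x = Num.min (f x) (g x). Proof. by []. Qed.

Lemma contW_addE f g x : (f + g) x = f x + g x. Proof. by []. Qed.

Lemma contW_scaleE (c : R) f x : (c *: f) x = c * f x. Proof. by []. Qed.

End contWE.

Record finW (R : realType) (X : topologicalType) := FinW {
  finW_fun :> continuousType X R ;
  finW_finite : finite_set (range finW_fun) }.

Section F_wstar.
Context (R : realType) (X : topologicalType).

HB.instance Definition _ := gen_eqMixin (finW R X).
HB.instance Definition _ := gen_choiceMixin (finW R X).

Let F_inj (f g : finW R X) : (f : X -> R) =1 g -> f = g.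
Proof.
case: f g => [f fP] [g gP] /= /continuousEP fg; case: _ / fg gP => gP.
by congr FinW; exact: Prop_irrelevance.
Qed.

Let cst_finite (c : R) : finite_set (range (cst c : X -> R)).
Proof. by apply: (@sub_finite_set _ _ [set c]) => [_ [x _ <-]|]. Qed.

Let range2_finite (h : R -> R -> R) (f g : finW R X) :
  finite_set (range (fun x => h (f x) (g x))).
Proof.
apply: (@sub_finite_set _ _ [set h a b | a in range f & b in range g]).
  by move=> _ [x _ <-]; exists (f x); [exists x|exists (g x) => //; exists x].
by apply: finite_image2; exact: finW_finite.
Qed.

Let F_bounded (f : finW R X) : exists M : R, forall x, f x <= M.
Proof.
by apply: compact_range_bounded; apply: finite_compact; exact: finW_finite.
Qed.

Let F_one : finW R X := @FinW R X (cst 1) (cst_finite 1).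
Let F_zero : finW R X := @FinW R X (cst 0) (cst_finite 0).
Let F_opp (f : finW R X) : finW R X :=
  @FinW R X (mkcts (@cont_opp R X f)) (range2_finite (fun a _ => - a) f f).
Let F_add (f g : finW R X) : finW R X :=
  @FinW R X (mkcts (@cont_add R X f g)) (range2_finite +%R f g).
Let F_scale (c : R) (f : finW R X) : finW R X :=
  @FinW R X (mkcts (@cont_scale R X c f))
    (range2_finite (fun a _ => c * a) f f).
Let F_max (f g : finW R X) : finW R X :=
  @FinW R X (mkcts (@cont_max R X f g)) (range2_finite Num.max f g).
Let F_min (f g : finW R X) : finW R X :=
  @FinW R X (mkcts (@cont_min R X f g)) (range2_finite Num.min f g).
Let F_oneE x : F_one x = 1. Proof. by []. Qed.
Let F_zeroE x : F_zero x = 0. Proof. by []. Qed.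
Let F_oppE f x : F_opp f x = - f x. Proof. by []. Qed.
Let F_addE f g x : F_add f g x = f x + g x. Proof. by []. Qed.
Let F_scaleE c f x : F_scale c f x = c * f x. Proof. by []. Qed.
Let F_maxE f g x : F_max f g x = Num.max (f x) (g x). Proof. by []. Qed.
Let F_minE f g x : F_min f g x = Num.min (f x) (g x). Proof. by []. Qed.

HB.instance Definition _ := FunLattice_isWstar.Build R (finW R X) F_inj
  F_oneE F_zeroE F_oppE F_addE F_scaleE F_maxE F_minE F_bounded.

End F_wstar.

Section vabs_theory.
Context (R : realType) (A : vectorLatticeType R).
Implicit Types x y z : A.

Lemma vlat_leD x y z w : x <= y -> z <= w -> x + z <= y + w.
Proof.
move=> xy zw; apply: (le_trans (vlat_leD2r _ _ z xy)).
by rewrite ![y + _]addrC; exact: vlat_leD2r.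
Qed.

Lemma vlat_subr_ge0 x y : (0 <= y - x) = (x <= y).
Proof.
apply/idP/idP => h; first by have := vlat_leD2r _ _ x h; rewrite add0r subrK.
by have := vlat_leD2r _ _ (- x) h; rewrite subrr.
Qed.

Lemma vlat_leZ (c : R) x y : 0 <= c -> x <= y -> c *: x <= c *: y.
Proof.
move=> c0; rewrite -vlat_subr_ge0 => xy.
by rewrite -vlat_subr_ge0 -scalerBr; exact: vlat_scale_ge0.
Qed.

Lemma vabs_le x z : (vabs x <= z) = (x <= z) && (- x <= z).
Proof. exact: vjoin_le. Qed.

Lemma ler_vabs x : (x <= vabs x) && (- x <= vabs x).
Proof. by rewrite -vabs_le. Qed.

Lemma vabs_ge0 x : 0 <= vabs x.
Proof.
have /andP[x1 x2] := ler_vabs x.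
have := vlat_leD x1 x2; rewrite subrr -mulr2n -scaler_nat => h.
have c0 : 0 <= 2^-1 :> R by rewrite invr_ge0 ler0n.
have := vlat_scale_ge0 _ _ c0 h.
by rewrite scalerA mulVf ?scale1r// pnatr_eq0.
Qed.

Lemma vabs_id x : 0 <= x -> vabs x = x.
Proof.
move=> x0; have /andP[x1 _] := ler_vabs x.
apply/eqP; rewrite eq_le x1 andbT vabs_le lexx/=.
by apply: (le_trans _ x0); rewrite -vlat_subr_ge0 sub0r opprK.
Qed.

Lemma vabsD x y : vabs (x + y) <= vabs x + vabs y.
Proof.
have /andP[x1 x2] := ler_vabs x; have /andP[y1 y2] := ler_vabs y.
by rewrite vabs_le opprD !vlat_leD.
Qed.

Lemma vabsZ (c : R) x : vabs (c *: x) <= `|c| *: vabs x.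
Proof.
wlog c0 : c x / 0 <= c.
  move=> h; have [|/ltW c0] := leP 0 c; first exact: h.
  have := h (- c) (- x); rewrite oppr_ge0 normrN.
  have -> : - c *: - x = c *: x by rewrite scalerN scaleNr opprK.
  have /andP[x1 x2] := ler_vabs x.
  by move=> /(_ c0)/le_trans; apply; rewrite vlat_leZ// vabs_le opprK x2.
have /andP[x1 x2] := ler_vabs x.
by rewrite ger0_norm// vabs_le -scalerN !vlat_leZ.
Qed.

End vabs_theory.

Section yosida.
Context (R : realType) (A : wstarType R).

Definition is_ideal (I : set A) : Prop :=
  [/\ I 0,
      forall x y, I x -> I y -> I (x + y),
      forall (c : R) x, I x -> I (c *: x)
    & forall x y, vabs x <= vabs y -> I y -> I x].

Definition maximal_without_unit (M : set A) : Prop :=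
  [/\ is_ideal M, ~ M wunit
    & forall N, is_ideal N -> ~ N wunit -> M `<=` N -> N = M].

Record Yosida := MkYosida {
  ideal :> set A ;
  yosidaP : maximal_without_unit ideal }.

HB.instance Definition _ := gen_eqMixin Yosida.
HB.instance Definition _ := gen_choiceMixin Yosida.

Lemma yosida_vabs (M : Yosida) x : ideal M (vabs x) <-> ideal M x.
Proof.
have [[_ _ _ solid] _ _] := yosidaP M.
by split; apply: solid; rewrite [vabs (vabs x)]vabs_id ?vabs_ge0.
Qed.

Lemma yosida_notin (M : Yosida) (a : A) : ~ ideal M a ->
  exists2 m, ideal M m & exists n : nat, wunit <= vabs m + n%:R *: vabs a.
Proof.
move=> Ma; apply: contrapT => noub.
have [[M0 MD MZ Msolid] Mu Mmax] := yosidaP M.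
pose N := [set x : A | exists2 m, ideal M m
  & exists n : nat, vabs x <= vabs m + n%:R *: vabs a].
have NM : N = ideal M.
  apply: Mmax.
  - split.
    + exists 0 => //; exists 0; rewrite scale0r addr0.
      exact: lexx.
    + move=> x y [m Mm [n xmn]] [m' Mm' [n' xmn']].
      exists (vabs m + vabs m'); first by apply: (MD); exact/yosida_vabs.
      exists (n + n')%N; rewrite (vabs_id (x := vabs m + vabs m')); last first.
        by rewrite -[0]addr0 vlat_leD ?vabs_ge0.
      by rewrite natrD scalerDl addrACA (le_trans (vabsD _ _))// vlat_leD.
    + move=> c x [m Mm [n xmn]].
      exists (`|c| *: vabs m); first by apply: MZ; exact/yosida_vabs.
      exists (Num.bound `|c| * n)%N.
      rewrite (vabs_id (x := `|c| *: vabs m)); last first.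
        by rewrite vlat_scale_ge0 ?vabs_ge0.
      apply: (le_trans (vabsZ _ _)); apply: (le_trans (vlat_leZ _ xmn)) => //.
      rewrite scalerDr vlat_leD// natrM scalerA -vlat_subr_ge0 -scalerBl.
      rewrite -mulrBl vlat_scale_ge0 ?vabs_ge0// mulr_ge0// subr_ge0.
      by apply: ltW; exact: archi_boundP.
    + move=> x y xy [m Mm [n ymn]]; exists m => //; exists n.
      exact: le_trans xy ymn.
  - move=> [m Mm [n umn]]; apply: noub; exists m => //; exists n.
    by rewrite -(vabs_id wunit_ge0).
  - by move=> x Mx; exists x => //; exists 0; rewrite scale0r addr0.
apply: Ma; rewrite -NM; exists 0 => //; exists 1.
by rewrite scale1r (vabs_id (lexx 0)) add0r.
Qed.

Lemma yosida_prime (M : Yosida) (a b : A) :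
  ideal M (vmeet (vabs a) (vabs b)) <-> ideal M a \/ ideal M b.
Proof.
have [[M0 MD MZ Msolid] Mu Mmax] := yosidaP M.
have meet_le (x y : A) : (vmeet x y <= x) && (vmeet x y <= y) :> bool.
  by rewrite -le_vmeet.
have /andP[leA leB] := meet_le (vabs a) (vabs b).
have meet0 : 0 <= vmeet (vabs a) (vabs b) by rewrite le_vmeet !vabs_ge0.
split=> [Mab|[Ma|Mb]]; last 2 first.
- by apply: Msolid Ma; rewrite vabs_id.
- by apply: Msolid Mb; rewrite vabs_id.
apply: contrapT => /not_orP[].
move=> /yosida_notin[m Mm [n umn]] /yosida_notin[m' Mm' [n' umn']].
apply: Mu; pose k := (n + n').+1.
have k0 : 0 < k%:R :> R by rewrite ltr0n.
have kV0 : 0 <= k%:R^-1 :> R by rewrite invr_ge0 ltW.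
pose s := vabs m + vabs m'.
have bound c j m1 : (j <= k)%N -> vabs m1 <= s ->
    wunit <= vabs m1 + j%:R *: vabs c -> k%:R^-1 *: (wunit - s) <= vabs c.
  move=> jk m1s h; have -> : vabs c = k%:R^-1 *: (k%:R *: vabs c).
    by rewrite scalerA mulVf ?scale1r ?lt0r_neq0.
  apply: vlat_leZ => //; rewrite -vlat_subr_ge0 opprB addrA vlat_subr_ge0 addrC.
  apply: (le_trans h); apply: vlat_leD => //.
  rewrite -vlat_subr_ge0 -scalerBl vlat_scale_ge0 ?vabs_ge0//.
  by rewrite subr_ge0 ler_nat.
have : k%:R^-1 *: (wunit - s) <= vmeet (vabs a) (vabs b).
  rewrite le_vmeet (bound _ _ _ _ _ umn) ?(bound _ _ _ _ _ umn')//.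
  - by rewrite /k leqW// leq_addl.
  - by rewrite -[leLHS]add0r vlat_leD ?vabs_ge0.
  - by rewrite /k leqW// leq_addr.
  - by rewrite -[leLHS]addr0 vlat_leD ?vabs_ge0.
move=> /(vlat_leZ (ltW k0)); rewrite scalerA divff ?lt0r_neq0// scale1r => h.
apply: (Msolid _ (k%:R *: vmeet (vabs a) (vabs b) + s)); last first.
  apply: (MD); first exact: MZ.
  by apply: (MD); exact/yosida_vabs.
have : wunit <= k%:R *: vmeet (vabs a) (vabs b) + s.
  by have := vlat_leD2r _ _ s h; rewrite subrK.
move=> /le_trans; rewrite (vabs_id wunit_ge0); apply.
by case/andP: (ler_vabs (k%:R *: vmeet (vabs a) (vabs b) + s)).
Qed.

(* Hull-kernel topology: the closed sets are the hulls {M | S `<=` M}.        *)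
Definition yosida_open (U : set Yosida) : Prop :=
  exists S : set A, U = [set M : Yosida | ~ (S `<=` M)].

Let yosida_openT : yosida_open setT.
Proof.
exists setT; apply/seteqP; split => // M _ /= h.
by have [_ Mu _] := yosidaP M; apply/Mu/h.
Qed.

Let yosida_openI : setI_closed yosida_open.
Proof.
move=> _ _ [S ->] [T ->].
exists [set c | exists a b, [/\ S a, T b & c = vmeet (vabs a) (vabs b)]].
apply/seteqP; split => M /=.
  move=> [/existsNP[a /not_implyP[Sa Ma]] /existsNP[b /not_implyP[Tb Mb]]] h.
  by have /yosida_prime[] := h (vmeet (vabs a) (vabs b))
    (ex_intro _ a (ex_intro _ b (And3 Sa Tb erefl))).
move=> h; split => SM; apply: h => _ [a [b [Sa Tb ->]]]; apply/yosida_prime.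
  by left; exact: SM.
by right; exact: SM.
Qed.

Let yosida_open_bigU (I : Type) (f : I -> set Yosida) :
  (forall i, yosida_open (f i)) -> yosida_open (\bigcup_i f i).
Proof.
move=> fo; pose S i := sval (cid (fo i)).
have fE i : f i = [set M : Yosida | ~ (S i `<=` M)] := svalP (cid (fo i)).
exists (\bigcup_i S i); apply/seteqP; split => M /=.
  by move=> [i _]; rewrite fE => h SM; apply: h => a Sa; apply: SM; exists i.
move=> h; apply: contrapT => nU; apply: h => a [i _ Sa].
apply: contrapT => Ma; apply: nU; exists i => //; rewrite fE => SM.
exact/Ma/SM.
Qed.

HB.instance Definition _ :=
  isOpenTopological.Build Yosida yosida_openT yosida_openI yosida_open_bigU.

(* The quotient of A by M is R with unit 1, so exactly one r qualifies.       *)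
Definition nu (a : A) (M : Yosida) : R :=
  xget 0 [set r | ideal M (a - r *: wunit)].

End yosida.

Definition homeomorphism (X Y : topologicalType) (f : X -> Y) : Prop :=
  continuous f /\
  exists g : Y -> X, [/\ continuous g, cancel f g & cancel g f].

Definition homeomorphic (X Y : topologicalType) : Prop :=
  exists f : X -> Y, homeomorphism f.

Definition extremally_disconnected (X : topologicalType) : Prop :=
  forall U : set X, open U -> open (closure U).

(* On compact Hausdorff spaces the library's zero_dimensional (clopen sets    *)
(* separate points) says that the clopen sets form a base.                    *)
Lemma zero_dimensional_clopen_base (X : compHausType) :
  zero_dimensional X <->
  forall (x : X) (U : set X), nbhs x U ->
    exists V : set X, [/\ clopen V, V x & V `<=` U].
Proof.
split=> [zX x U xU|base x y xy].
  have /(_ U xU)[V [Vx cV] VU] :=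
    @zero_dimensional_cvg X x ch_hausdorff zX ch_compact.
  by exists V.
have [U Ux Uy] : exists2 U, nbhs x U & ~ U y.
  apply: contrapT => h; move/eqP: xy; apply.
  apply: ch_hausdorff => U V xU yV; exists y; split; last exact: nbhs_singleton.
  by apply: contrapT => Uy; apply: h; exists U.
have [V [cV Vx VU]] := base x U Ux.
by exists V; split => // /VU.
Qed.

Section identification.
Local Open Scope quotient_scope.
Context (E : topologicalType) (p q : E).

Let Edot_rel' (x y : E) : bool :=
  (x == y) || ((x \in [:: p; q]) && (y \in [:: p; q])).

Let Edot_rel_refl : reflexive Edot_rel'.
Proof. by move=> x; rewrite /Edot_rel' eqxx. Qed.

Let Edot_rel_sym : symmetric Edot_rel'.
Proof. by move=> x y; rewrite /Edot_rel' eq_sym andbC. Qed.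

Let Edot_rel_trans : transitive Edot_rel'.
Proof.
move=> y x z /predU1P[->//|/andP[xpq ypq]] /predU1P[<-|/andP[_ zpq]];
  by rewrite /Edot_rel' xpq ?ypq ?zpq orbT.
Qed.

Definition Edot_rel := EquivRel _ Edot_rel_refl Edot_rel_sym Edot_rel_trans.

Definition Edot : Type := {eq_quot Edot_rel}.
HB.instance Definition _ := Topological.copy Edot (quotient_topology Edot).
HB.instance Definition _ := Quotient.on Edot.

Definition gamma : E -> Edot := \pi_Edot.

Lemma gamma_continuous : continuous gamma.
Proof. exact: pi_continuous. Qed.

HB.instance Definition _ :=
  isContinuous.Build E Edot gamma gamma_continuous.

End identification.

(* A covering operator c, read up to homeomorphism: c X Z f says that c       *)
(* assigns to X the cover (Z, f).                                             *)
Definition cover_assignment : Type :=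
  forall X Z : topologicalType, (Z -> X) -> Prop.

(* Identifying X with Edot p q along a homeomorphism h turns the cover        *)
(* (E, gamma p q) into (E, h \o gamma p q), the space E itself being kept     *)
(* fixed; when X is not Edot p q, identifying Z with X along a homeomorphism  *)
(* f turns the cover (X, id) into (Z, f).                                     *)
Inductive a_gamma (E : topologicalType) (p q : E) (X : topologicalType) :
    forall Z : topologicalType, (Z -> X) -> Prop :=
| a_gamma_Edot (h : Edot p q -> X) :
    homeomorphism h -> @a_gamma E p q X E (h \o gamma p q)
| a_gamma_id (Z : topologicalType) (f : Z -> X) :
    ~ homeomorphic X (Edot p q) -> homeomorphism f -> @a_gamma E p q X Z f.

Section hull.
Context (R : realType) (c : cover_assignment).

(* mu(c)A = C(Z), with i as the embedding mu(c)_A.                            *)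
Definition is_mu (A : wstarType R) (Z : compHausType)
    (i : A -> contW R Z) : Prop :=
  exists2 f : Z -> Yosida A,
    c f & forall (a : A) (z : Z), i a z = nu a (f z).

Record Wover (H : wstarType R) := MkWover {
  Wover_obj :> wstarType R ;
  Wover_map : Wover_obj -> H }.

Definition Vclass (Y : compHausType) (A : Wover (contW R Y)) : Prop :=
  is_mu (@Wover_map _ A).

Definition Wover_le (H : wstarType R) (A1 A2 : Wover H) : Prop :=
  exists2 f : A1 -> A2, essential_embedding f
    & forall a, Wover_map a = Wover_map (f a).

Definition is_minimum (H : wstarType R) (S : Wover H -> Prop)
    (A : Wover H) : Prop :=
  S A /\ forall B, S B -> Wover_le A B.

End hull.

(* F(X), mapped to C(Z) by composition with g.                                *)
Definition finW_over (R : realType) (Z : compHausType) (X : topologicalType)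
    (g : continuousType Z X) : Wover (contW R Z) :=
  @MkWover R (contW R Z) (finW R X) (fun f => (f \o g : continuousType Z R)).

(* Main.v *)
From HB Require Import structures.
Require Import Defs.
From mathcomp Require Import all_boot all_order all_algebra generic_quotient.
From mathcomp Require Import all_classical all_reals all_analysis.
From mathcomp Require Import lra.
Set Implicit Arguments.
Unset Strict Implicit.
Unset Printing Implicit Defensive.
Import Order.TTheory GRing.Theory Num.Theory.
Import numFieldNormedType.Exports.
Local Open Scope classical_set_scope.
Local Open Scope ring_scope.

(** Write [S(X)] for the class of all [A] whose Yosida space is [X]; an object
    of [S(X)] is a vector sublattice of [C(X)] that contains the constants and
    separates points, so minimality is a question about such sublattices.

    _Finite-valued functions lie in everything that can contain them._ Let [B]
    be represented on a compact space [Z], and let [k] be continuous on [Z] with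
    finitely many values. If any two points at which [k] differs are separated
    by [B], then [k] is in the image of [B]: for a clopen level set [U] of [k],
    finite meets and joins of elements of [B] that take prescribed values at one
    point of [U] and one point outside produce a function above [1] on [U] and
    below [0] off [U]; truncating it gives the indicator of [U]
    ([clopen_indicator], [finite_valued_realized]). Hence [F(X)], pulled back
    along [g : Z -> X], embeds in every [B] whose points separate what [g]
    separates. The embedding is essential when every nonempty open subset of
    [Z] contains the preimage of a nonempty clopen subset of [X]
    ([finW_over_le]). For [g = id] this is zero-dimensionality; for [g = gamma]
    it holds because a nonempty open set of [E] has points other than the
    non-isolated [p] and [q], and a clopen set that misses both is saturated
    ([gamma_irreducible]).

    _[F(X)] belongs to the class._ Over a zero-dimensional [X], [F(X)] separates
    points, so its Yosida space is [X] by the representation theorem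
    ([representation_homeomorphism], [finW_representation]). The space [E] is
    zero-dimensional because it is extremally disconnected, and its quotient
    inherits this by saturating clopen sets ([zero_dimensional_Edot]).

    _A minimum forces zero-dimensionality._ For each point [x0] of [Y], the
    functions that are constant on some neighbourhood of [x0] form a vector
    sublattice that contains the constants, and it still separates points, by
    Urysohn's lemma; so it belongs to the class over [Y]. A minimum embeds in
    all of these sublattices, hence consists of locally constant functions; and
    it separates points, so clopen level sets do
    ([minimum_zero_dimensional]).

    The dictionary between abstract objects and functions rests on the Yosida
    representation: the points of the Yosida space are the kernels of the
    characters of [A] ([char_kernel_maximal], [nu_character]), and the
    Archimedean property makes the characters jointly faithful
    ([yosida_point_notin], [nu_inj]). *)

(** * Inequalities in vector lattices *)

Section vector_lattice.
Context (R : realType) (A : vectorLatticeType R).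
Implicit Types (a b x y z : A) (c d : R).

Lemma vlat_subr_le x y z : (x - y <= z) = (x <= z + y).
Proof. by rewrite -(vlat_subr_ge0 (x - y)) -(vlat_subr_ge0 x) opprB addrA. Qed.

Lemma vlat_leN2 x y : (- x <= - y) = (y <= x).
Proof. by rewrite -(vlat_subr_ge0 (- x)) opprK addrC vlat_subr_ge0. Qed.

Lemma vlat_leZl c d x : 0 <= x -> c <= d -> c *: x <= d *: x.
Proof.
move=> x0 cd; rewrite -vlat_subr_ge0 -scalerBl vlat_scale_ge0//.
by rewrite subr_ge0.
Qed.

Lemma vlat_le_pZ2 c x y : 0 < c -> (c *: x <= c *: y) = (x <= y).
Proof.
move=> c0; apply/idP/idP => [|xy]; last exact: (vlat_leZ (ltW c0)).
have cV : 0 <= c^-1 by rewrite invr_ge0 ltW.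
by move/(vlat_leZ cV); rewrite !scalerA mulVf ?lt0r_neq0// !scale1r.
Qed.

Lemma vjoin_ge x y : (x <= vjoin x y) /\ (y <= vjoin x y).
Proof. by apply/andP; rewrite -vjoin_le. Qed.

Lemma vmeet_le x y : (vmeet x y <= x) /\ (vmeet x y <= y).
Proof. by apply/andP; rewrite -le_vmeet. Qed.

Lemma le_vmeet_eq x y : x <= y -> vmeet x y = x.
Proof.
move=> xy; apply/eqP; rewrite eq_le (vmeet_le x y).1/=.
by rewrite le_vmeet lexx.
Qed.

Lemma vjoin_eq_le x y : vjoin x y = y -> x <= y.
Proof. by move<-; exact: (vjoin_ge _ _).1. Qed.

Lemma le_vjoin_eq x y : x <= y -> vjoin x y = y.
Proof.
move=> xy; apply/eqP; rewrite eq_le (vjoin_ge x y).2 andbT.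
by rewrite vjoin_le xy lexx.
Qed.

Lemma vmeetC x y : vmeet x y = vmeet y x.
Proof.
suff h a b : vmeet a b <= vmeet b a by apply/eqP; rewrite eq_le !h.
by have [h1 h2] := vmeet_le a b; rewrite le_vmeet h1 h2.
Qed.

Lemma vmeet_le2 x y x' y' : x <= x' -> y <= y' -> vmeet x y <= vmeet x' y'.
Proof.
move=> xx yy; have [h1 h2] := vmeet_le x y.
by rewrite le_vmeet (le_trans h1)// (le_trans h2).
Qed.

Lemma vmeetN x y : vmeet x y = - vjoin (- x) (- y).
Proof.
apply/eqP; rewrite eq_le; apply/andP; split.
  rewrite -vlat_leN2 opprK vjoin_le !vlat_leN2.
  by have [-> ->] := vmeet_le x y.
have [h1 h2] := vjoin_ge (- x) (- y).
by rewrite le_vmeet -vlat_leN2 opprK h1 -vlat_leN2 opprK h2.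
Qed.

Lemma vmeetDr x y z : vmeet x y + z = vmeet (x + z) (y + z).
Proof.
apply/eqP; rewrite eq_le; apply/andP; split.
  by have [h1 h2] := vmeet_le x y; rewrite le_vmeet !vlat_leD2r.
have [h1 h2] := vmeet_le (x + z) (y + z).
by rewrite -vlat_subr_le le_vmeet !vlat_subr_le h1 h2.
Qed.

Lemma vmeetZ c x y : 0 < c -> vmeet (c *: x) (c *: y) = c *: vmeet x y.
Proof.
move=> c0; apply/eqP; rewrite eq_le; apply/andP; split; last first.
  by have [h1 h2] := vmeet_le x y; rewrite le_vmeet !vlat_le_pZ2 ?h1.
have cV : 0 < c^-1 by rewrite invr_gt0.
rewrite -(vlat_le_pZ2 _ _ cV) scalerA mulVf ?lt0r_neq0// scale1r le_vmeet.
have [h1 h2] := vmeet_le (c *: x) (c *: y).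
move: h1 h2; rewrite -(vlat_le_pZ2 _ _ cV) => h1.
rewrite -(vlat_le_pZ2 _ _ cV) => h2; move: h1 h2.
by rewrite !scalerA mulVf ?lt0r_neq0// !scale1r => -> ->.
Qed.

(** The two parts satisfy [x+ = x + x-], so translating by [x-] turns
    [x+ /\ x-] into [x /\ 0 = - x-]. *)
Lemma vmeet_pos_neg x : vmeet (vjoin x 0) (vjoin (- x) 0) = 0.
Proof.
have [p1 p2] := vjoin_ge x 0; have [n1 n2] := vjoin_ge (- x) 0.
have posE : vjoin x 0 = x + vjoin (- x) 0.
  apply/eqP; rewrite eq_le vjoin_le -[X in X <= x + _]addr0 vlat_leD//=.
  rewrite -[X in X <= x + _](subrr x) vlat_leD//=.
  rewrite addrC -[X in _ + X]opprK vlat_subr_le vjoin_le.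
  by rewrite -[X in X <= _]sub0r vlat_leD//= vlat_subr_ge0.
rewrite posE -[X in vmeet _ X]add0r -vmeetDr vmeetN oppr0 addNr//.
Qed.

Lemma vmeet_ge0 x y : 0 <= x -> 0 <= y -> 0 <= vmeet x y.
Proof. by rewrite le_vmeet => -> ->. Qed.

Lemma vlat_addr_ge0 x y : 0 <= x -> 0 <= y -> 0 <= x + y.
Proof. by move=> x0 y0; rewrite -[leLHS]addr0 vlat_leD. Qed.

Lemma le_vabs x : x <= vabs x.
Proof. by have /andP[] := ler_vabs x. Qed.

Lemma vabsN x : vabs (- x) = vabs x.
Proof.
suff h y : vabs (- y) <= vabs y.
  by apply/eqP; rewrite eq_le h -{1}[x]opprK h.
by rewrite vabs_le opprK andbC; exact: ler_vabs.
Qed.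

Lemma vlat_leDl x y : 0 <= y -> x <= x + y.
Proof. by move=> y0; rewrite -[leLHS]addr0 vlat_leD. Qed.

Lemma vlat_leDr x y : 0 <= y -> x <= y + x.
Proof. by rewrite addrC; exact: vlat_leDl. Qed.

End vector_lattice.

(** * Points of the Yosida space as characters *)

Section yosida_points.
Context (R : realType) (A : wstarType R).
Implicit Types (a b : A) (M : Yosida A) (I : set A).
Local Notation u := (wunit : A).

Lemma ideal_squeeze I a b : is_ideal I -> 0 <= a -> a <= b -> I b -> I a.
Proof.
move=> [_ _ _ solid] a0 ab; apply: solid.
by rewrite !vabs_id// (le_trans a0).
Qed.

Lemma ideal_vabs_le I a b : is_ideal I -> vabs a <= b -> I b -> I a.
Proof.
move=> [_ _ _ solid] ab; apply: solid; apply: (le_trans ab); exact: le_vabs.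
Qed.

Lemma wunit_scale_le (r s : R) : r <= s -> r *: u <= s *: u.
Proof. by apply: vlat_leZl; exact: wunit_ge0. Qed.

(** The value is the infimum [r] of the [s] with [(a - s u)+] in [M]. Since [M]
    is prime, [(a - s u)-] is in [M] for [s < r], so modulo [M] the element
    [a - r u] is smaller than every [e u]; if it were not in [M], maximality
    would bound [u] by a multiple of it modulo [M]. *)
Lemma yosida_value_exists M a : exists r, ideal M (a - r *: u).
Proof.
have [IM Mu _] := yosidaP M; have [M0 MD MZ _] := IM.
have [n an] := wunit_strong a.
pose S := [set s : R | ideal M (vjoin (a - s *: u) 0)].
have Sn : S n%:R.
  rewrite /S/= scaler_nat le_vjoin_eq// vlat_subr_le add0r.
  exact: le_trans (le_vabs a) an.
have lbS : lbound S (- n%:R).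
  move=> s Ss; rewrite leNgt; apply/negP => sn.
  have c0 : 0 < - n%:R - s by rewrite subr_gt0.
  have cV : 0 < (- n%:R - s)^-1 by rewrite invr_gt0.
  apply: Mu; apply: (ideal_squeeze IM wunit_ge0 _ (MZ (- n%:R - s)^-1 _ Ss)).
  rewrite -(vlat_le_pZ2 _ _ c0) scalerA mulfV ?lt0r_neq0// scale1r.
  apply: le_trans (vjoin_ge _ _).1.
  rewrite scalerBl vlat_leD2r// scaleNr scaler_nat -vlat_leN2 opprK.
  by have /andP[_ h] := ler_vabs a; exact: le_trans h an.
have Sup s t : s <= t -> S s -> S t.
  move=> st; apply: ideal_squeeze => //; first exact: (vjoin_ge _ _).2.
  rewrite vjoin_le (vjoin_ge _ _).2 andbT (le_trans _ (vjoin_ge _ _).1)//.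
  by rewrite vlat_leD// vlat_leN2 wunit_scale_le.
have infS : has_inf S by split; [exists n%:R|exists (- n%:R)].
pose r := inf S; exists r; apply: contrapT => /yosida_notin[m Mm [k umk]].
(* Small enough for k * |a - r u| to be at most u / 2 modulo M. *)
pose e : R := (k.+1%:R)^-1 / 2.
have e0 : 0 < e by rewrite divr_gt0// invr_gt0.
have ke : k%:R * e <= 2^-1.
  rewrite /e mulrA -[leRHS]mul1r ler_pM2r ?invr_gt0// ler_pdivrMr// mul1r.
  by rewrite ler_nat.
pose p1 := vjoin (a - (r + e) *: u) 0.
pose p2 := vjoin (- (a - (r - e) *: u)) 0.
have Mp1 : ideal M p1.
  by have [s Ss /ltW sr] := inf_adherent e0 infS; exact: Sup Ss.
have Mp2 : ideal M p2.
  pose x := a - (r - e) *: u.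
  have NS : ~ S (r - e).
    by move=> /(ge_inf infS.2); rewrite lerBrDl gerDr leNgt e0.
  have pos0 (y : A) : 0 <= vjoin y 0 by exact: (vjoin_ge _ _).2.
  have /yosida_prime[//|//] :
    ideal M (vmeet (vabs (vjoin x 0)) (vabs (vjoin (- x) 0))).
  by rewrite !vabs_id// vmeet_pos_neg.
have p10 : 0 <= p1 := (vjoin_ge _ _).2.
have p20 : 0 <= p2 := (vjoin_ge _ _).2.
have bound : vabs (a - r *: u) <= e *: u + (p1 + p2).
  rewrite vabs_le; apply/andP; split.
    rewrite addrA (le_trans _ (vlat_leDl _ p20))// addrC -vlat_subr_le.
    rewrite -addrA -opprD -scalerDl; exact: (vjoin_ge _ _).1.
  rewrite [p1 + p2]addrC addrA (le_trans _ (vlat_leDl _ p10))// addrC.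
  rewrite -vlat_subr_le.
  have -> : - (a - r *: u) - e *: u = - (a - (r - e) *: u).
    by rewrite -opprD -addrA scalerBl [- (r *: u - _)]opprB [e *: u - _]addrC.
  exact: (vjoin_ge _ _).1.
apply: Mu; pose w := vabs m + k%:R *: (p1 + p2).
have Mw : ideal M w.
  apply: (MD); first exact/yosida_vabs.
  by apply: MZ; exact: MD.
have w0 : 0 <= w.
  by rewrite vlat_addr_ge0 ?vabs_ge0// vlat_scale_ge0// vlat_addr_ge0.
apply: (ideal_squeeze IM wunit_ge0 _ (MZ 2 _ Mw)).
have h0 : 0 < 2^-1 :> R by rewrite invr_gt0.
rewrite -(vlat_le_pZ2 _ _ h0) scalerA mulVf// scale1r.
have -> : 2^-1 *: u = u - 2^-1 *: u.
  by rewrite -[X in _ = X - _]scale1r -scalerBl; congr (_ *: _); lra.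
rewrite vlat_subr_le (le_trans umk)// /w -addrA vlat_leD//.
apply: (le_trans (vlat_leZ (ler0n _ k) bound)).
by rewrite scalerDr addrC vlat_leD// scalerA wunit_scale_le.
Qed.

Lemma yosida_value_unique M a r s :
  ideal M (a - r *: u) -> ideal M (a - s *: u) -> r = s.
Proof.
have [[M0 MD MZ _] Mu _] := yosidaP M.
move=> ar as_; apply/eqP; rewrite -subr_eq0; apply/negPn/negP => rs.
apply: Mu; have := MZ (r - s)^-1 _ (MD _ _ as_ (MZ (-1) _ ar)).
rewrite scaleN1r opprB [_ + (_ - a)]addrC addrA subrK -scalerBl scalerA.
rewrite mulVf// scale1r.
by [].
Qed.

Lemma ideal_subr_nu M a : ideal M (a - nu a M *: u).
Proof. exact: xgetPex (yosida_value_exists M a). Qed.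

Lemma nuE M a r : ideal M (a - r *: u) -> nu a M = r.
Proof. by apply: yosida_value_unique; exact: ideal_subr_nu. Qed.

Lemma nu_eq0 M a : nu a M = 0 <-> ideal M a.
Proof.
split=> [a0|Ma]; last by apply: nuE; rewrite scale0r subr0.
by have := ideal_subr_nu M a; rewrite a0 scale0r subr0.
Qed.

(** The [W*]-morphisms to [R]; compatibility with meets follows from that with
    joins and opposites. *)
Definition character (e : A -> R) : Prop :=
  [/\ forall c a b, e (c *: a + b) = c * e a + e b,
      forall a b, e (vjoin a b) = Num.max (e a) (e b)
    & e u = 1].

Section character_theory.
Context (e : A -> R) (he : character e).

Lemma char0 : e 0 = 0.
Proof.
by have [/(_ (-1) 0 0)] := he; rewrite scaleN1r oppr0 addr0 mulN1r addNr.
Qed.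

Lemma charZ c a : e (c *: a) = c * e a.
Proof. by have [/(_ c a 0)] := he; rewrite addr0 char0 addr0. Qed.

Lemma charD a b : e (a + b) = e a + e b.
Proof. by have [/(_ 1 a b)] := he; rewrite scale1r mul1r. Qed.

Lemma charN a : e (- a) = - e a.
Proof. by rewrite -scaleN1r charZ mulN1r. Qed.

Lemma charB a b : e (a - b) = e a - e b.
Proof. by rewrite charD charN. Qed.

Lemma char_join a b : e (vjoin a b) = Num.max (e a) (e b).
Proof. by case: he. Qed.

Lemma char_meet a b : e (vmeet a b) = Num.min (e a) (e b).
Proof. by rewrite vmeetN charN char_join !charN oppr_max !opprK. Qed.

Lemma char_unit : e u = 1.
Proof. by case: he. Qed.

Lemma char_abs a : e (vabs a) = `|e a|.
Proof. by rewrite char_join charN; case: (lerP 0 (e a)) => h;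
  [rewrite ger0_norm// max_l//; lra|rewrite ltr0_norm// max_r//; lra]. Qed.

Lemma char_le a b : a <= b -> e a <= e b.
Proof. by move/le_vjoin_eq <-; rewrite char_join le_max lexx. Qed.

(** An element [a] off the kernel generates [u] modulo the kernel, because
    [u - (e a)^-1 a] lies in it. *)
Lemma char_kernel_maximal : maximal_without_unit [set a | e a = 0].
Proof.
split.
- split => /=; first exact: char0.
  + by move=> a b a0 b0; rewrite charD a0 b0 addr0.
  + by move=> c a a0; rewrite charZ a0 mulr0.
  + move=> a b /char_le; rewrite !char_abs => ab b0; apply/eqP.
    by rewrite -normr_le0 (le_trans ab)// b0 normr0.
- by rewrite /= char_unit; apply/eqP; rewrite oner_eq0.
- move=> N [N0 ND NZ _] Nu kN; apply/seteqP; split => // a Na /=.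
  apply: contrapT => /eqP a0; apply: Nu.
  have Nr : N (u - (e a)^-1 *: a).
    by apply: kN; rewrite /= charB charZ char_unit mulVf// subrr.
  by have := ND _ _ Nr (NZ (e a)^-1 _ Na); rewrite subrK.
Qed.

Definition char_point : Yosida A := MkYosida char_kernel_maximal.

Lemma nu_char_point a : nu a char_point = e a.
Proof. by apply: nuE; rewrite /= charB charZ char_unit mulr1 subrr. Qed.

End character_theory.

(** The join is handled by the Birkhoff-type bound: replacing [a] and [b] by
    [r u] and [s u] moves [a \/ b] by at most [|a - r u| + |b - s u|], which
    lies in [M]. *)
Lemma nu_character M : character (fun a => nu a M).
Proof.
have [IM Mu _] := yosidaP M; have [M0 MD MZ _] := IM.
have nuH := ideal_subr_nu M.
split=> [c a b|a b|]; apply: nuE.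
- have -> : c *: a + b - (c * nu a M + nu b M) *: u
      = c *: (a - nu a M *: u) + (b - nu b M *: u).
    by rewrite scalerDl opprD -scalerA scalerBr addrACA.
  by apply: (MD) => //; exact: MZ.
- set t := vabs (a - nu a M *: u) + vabs (b - nu b M *: u).
  apply: (@ideal_vabs_le _ _ t) => //; last by apply: (MD); exact/yosida_vabs.
  have da x : x - nu x M *: u <= vabs (x - nu x M *: u) := le_vabs _.
  have db x : nu x M *: u - x <= vabs (x - nu x M *: u).
    by rewrite -vabsN opprB le_vabs.
  rewrite vabs_le opprB !vlat_subr_le vjoin_le.
  apply/andP; split; [apply/andP; split|].
  + rewrite -vlat_subr_le; apply: le_trans (vlat_leDl _ (vabs_ge0 _)).
    apply: le_trans (da a); rewrite vlat_leD// vlat_leN2 wunit_scale_le//.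
    by rewrite le_max lexx.
  + rewrite -vlat_subr_le; apply: le_trans (vlat_leDr _ (vabs_ge0 _)).
    apply: le_trans (da b); rewrite vlat_leD// vlat_leN2 wunit_scale_le//.
    by rewrite le_max lexx orbT.
  + have [ab|ba] := leP (nu a M) (nu b M).
      apply: (@le_trans _ _ (t + b)); last first.
        by rewrite vlat_leD// (vjoin_ge _ _).2.
      rewrite -vlat_subr_le; apply: le_trans (vlat_leDr _ (vabs_ge0 _)).
      exact: db.
    apply: (@le_trans _ _ (t + a)); last first.
      by rewrite vlat_leD// (vjoin_ge _ _).1.
    rewrite -vlat_subr_le; apply: le_trans (vlat_leDl _ (vabs_ge0 _)).
    exact: db.
- by rewrite scale1r subrr.
Qed.

Lemma yosida_eq M N : ideal M = ideal N -> M = N.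
Proof.
case: M N => [M hM] [N hN] /= MN; case: _ / MN hN => hN.
by congr MkYosida; exact: Prop_irrelevance.
Qed.

Lemma nu_separates M N : M <> N -> exists a, nu a M <> nu a N.
Proof.
move=> MN; apply: contrapT => h; apply: MN; apply: yosida_eq.
have eqMN a : nu a M = nu a N.
  by apply: contrapT => ne; apply: h; exists a.
by apply/seteqP; split => a /nu_eq0; [rewrite eqMN|rewrite -eqMN];
  move/nu_eq0.
Qed.

(** Zorn's lemma needs an upper bound for the empty chain too, so it is applied
    to the sets whose union with [I] is an ideal missing [u]. *)
Lemma yosida_extend I : is_ideal I -> ~ I u -> exists M, I `<=` ideal M.
Proof.
move=> II Iu.
pose P (J : set A) := is_ideal (J `|` I) /\ ~ (J `|` I) u.
have [F FP Ftot|M [[IM Mu] Mmax]] := @Zorn_bigcup A P.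
  have [F0|[J0 FJ0]] : F = set0 \/ exists J, F J.
    have [->|/set0P[J FJ]] := eqVneq F set0; [by left|by right; exists J].
    rewrite F0 bigcup_set0 /P set0U; split => //.
  have inU J x : F J -> (J `|` I) x -> (\bigcup_(X in F) X `|` I) x.
    by move=> FJ [Jx|Ix]; [left; exists J|right].
  have Uin x : (\bigcup_(X in F) X `|` I) x -> exists2 J, F J & (J `|` I) x.
    by move=> [[J FJ Jx]|Ix]; [exists J => //; left|exists J0 => //; right].
  split; last by move=> /Uin[J /FP[_ ]].
  split.
  - by apply: (inU J0) => //; right; case: II.
  - move=> x y /Uin[J FJ Jx] /Uin[K FK Ky].
    have [[_ JD _ _] _] := FP _ FJ; have [[_ KD _ _] _] := FP _ FK.
    have [JK|KJ] := Ftot _ _ FJ FK.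
      by apply: (inU K) => //; apply: KD => //; exact: (setSU JK).
    by apply: (inU J) => //; apply: JD => //; exact: (setSU KJ).
  - move=> c x /Uin[J FJ Jx]; have [[_ _ JZ _] _] := FP _ FJ.
    by apply: (inU J) => //; exact: JZ.
  - move=> x y xy /Uin[J FJ Jy]; have [[_ _ _ Js] _] := FP _ FJ.
    by apply: (inU J) => //; exact: Js xy Jy.
have hM : maximal_without_unit (M `|` I).
  split => // N IN Nu MN; apply: contrapT => NM.
  have NI : N `|` I = N by apply/setUidPl => x Ix; apply: MN; right.
  apply: (Mmax N); last by rewrite /P NI.
  split=> [x Mx|NsubM]; first by apply: MN; left.
  by apply: NM; apply/seteqP; split => // x /NsubM; left.
by exists (MkYosida hM) => x Ix; right.
Qed.

(** For [a > 0] some multiple [n a] is not below [u], by the Archimedean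
    property. The ideal generated by [(u - n a)+] then misses [u], since
    [(u - n a)+] is disjoint from [(n a - u)+ > 0]; a maximal ideal containing
    it cannot contain [a]. *)
Lemma yosida_point_notin a : 0 < a -> exists M, ~ ideal M a.
Proof.
move=> a0; have [n nau] : exists n : nat, ~ (a *+ n <= u).
  apply: contrapT => h; move: a0; rewrite lt_neqAle => /andP[/eqP an0 a0].
  apply: an0; apply/esym/(vlat_archimedean _ u) => // n.
  by apply: contrapT => na; apply: h; exists n.
pose d := vjoin (u - a *+ n) 0; pose c := vjoin (- (u - a *+ n)) 0.
have d0 : 0 <= d := (vjoin_ge _ _).2; have c0 : 0 <= c := (vjoin_ge _ _).2.
pose I := [set x : A | exists k : nat, vabs x <= d *+ k].
have II : is_ideal I.
  split.
  - by exists 0; rewrite vabs_id// mulr0n.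
  - move=> x y [k xk] [l yl]; exists (k + l)%N.
    by rewrite mulrnDr (le_trans (vabsD _ _))// vlat_leD.
  - move=> r x [k xk]; exists (Num.bound `|r| * k)%N.
    apply: (le_trans (vabsZ _ _)).
    apply: (@le_trans _ _ ((Num.bound `|r|)%:R *: vabs x)).
      by apply: vlat_leZl; [exact: vabs_ge0|exact/ltW/archi_boundP].
    by rewrite mulnC mulrnA -[leRHS]scaler_nat vlat_leZ.
  - by move=> x y xy [k yk]; exists k; exact: le_trans yk.
have [|M IM] := yosida_extend II.
  move=> [k]; rewrite (vabs_id wunit_ge0) => uk; apply: nau.
  have {}uk : u <= k.+1%:R *: d.
    by rewrite scaler_nat mulrSr (le_trans uk)// vlat_leDl.
  have uc0 : vmeet u c = 0.
    apply/eqP; rewrite eq_le [X in _ && X]vmeet_ge0 ?wunit_ge0// andbT.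
    have <- : k.+1%:R *: vmeet d c = 0 by rewrite vmeet_pos_neg scaler0.
    rewrite -vmeetZ// vmeet_le2// -[leLHS]scale1r vlat_leZl//.
    by rewrite ler1n.
  have [m cm] := wunit_strong c.
  have c_le0 : c <= 0.
    have cm1 : c <= m.+1%:R *: u.
      rewrite scaler_nat mulrSr (le_trans (le_vabs _))// (le_trans cm)//.
      by rewrite vlat_leDl// wunit_ge0.
    rewrite -(le_vmeet_eq cm1) vmeetC.
    have <- : m.+1%:R *: vmeet u c = 0 by rewrite uc0 scaler0.
    rewrite -vmeetZ// vmeet_le2// -[leLHS]scale1r vlat_leZl//.
    by rewrite ler1n.
  have := le_trans (vjoin_ge _ _).1 c_le0.
  by rewrite opprB vlat_subr_le add0r.
exists M => Ma; have [IdM Mu _] := yosidaP M; have [_ MD MZ _] := IdM.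
apply: Mu.
apply: (ideal_squeeze IdM wunit_ge0 _ (MD d (n%:R *: a) _ (MZ _ _ Ma))).
  by rewrite scaler_nat -vlat_subr_le; exact: (vjoin_ge _ _).1.
by apply: IM; exists 1; rewrite vabs_id// mulr1n.
Qed.

Lemma nu_le a b : (forall M, nu a M <= nu b M) -> a <= b.
Proof.
move=> ab; apply: vjoin_eq_le; apply: contrapT => ne.
have h0 : 0 <= vjoin a b - b by rewrite vlat_subr_ge0 (vjoin_ge _ _).2.
have [|M] := @yosida_point_notin (vjoin a b - b).
  rewrite lt_neqAle h0 andbT; apply/eqP => /esym/eqP.
  by rewrite subr_eq0 => /eqP.
apply; apply/nu_eq0; have hM := nu_character M.
by rewrite (charB hM) (char_join hM) max_r ?subrr.
Qed.

Lemma nu_inj a b : (forall M, nu a M = nu b M) -> a = b.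
Proof.
by move=> ab; apply/eqP; rewrite eq_le !nu_le// => M; rewrite ab.
Qed.

End yosida_points.

(** * General topology *)

Section general_topology.

(** Compactness as an induction principle: the complements of the sets with
    property [Q] generate a filter, and a cluster point of it in [K] would have
    no neighbourhood satisfying [Q]. *)
Lemma compact_set_ind (X : topologicalType) (K : set X) (Q : set X -> Prop) :
  compact K -> Q set0 -> (forall S T, S `<=` T -> Q T -> Q S) ->
  (forall S T, Q S -> Q T -> Q (S `|` T)) ->
  (forall x, K x -> exists2 U, nbhs x U & Q U) -> Q K.
Proof.
move=> cK Q0 Qsub QU Qloc; apply: contrapT => nQ.
pose F : set_system X := [set S | Q (K `\` S)].
have FF : Filter F.
  split; rewrite /F /=.
  - by rewrite setDT.
  - by move=> S T QS QT /=; rewrite setDIr; exact: QU.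
  - by move=> S T ST; apply: Qsub; exact: setDS.
have PF : ProperFilter F by split => //; rewrite /F /= setD0.
have [|x [Kx]] := cK F PF; first by rewrite /F /= setDv.
have [U xU QU'] := Qloc _ Kx.
move=> /(_ (~` U) U)[]//; last by move=> y [].
by rewrite /F /=; apply: Qsub QU' => y [_ /contrapT].
Qed.

Lemma compact_hausdorff_homeomorphism (X Y : topologicalType) (f : X -> Y) :
  compact [set: X] -> hausdorff_space Y -> continuous f -> injective f ->
  (forall y, exists x, f x = y) -> homeomorphism f.
Proof.
move=> cX hY cf injf surf; split => //.
pose g y := sval (cid (surf y)).
have gK y : f (g y) = y := svalP (cid (surf y)).
exists g; split => //; last by move=> x; apply: injf; rewrite gK.
apply/continuous_closedP => C cC.
have -> : g @^-1` C = f @` C.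
  apply/seteqP; split => [y Cy|_ [x Cx <-]]; first by exists (g y).
  by rewrite /preimage /= (injf _ _ (gK (f x))).
apply: compact_closed => //; apply: continuous_compact.
  exact: continuous_subspaceT.
exact: subclosed_compact cX _.
Qed.

Lemma homeomorphism_trans (X Y Z : topologicalType) :
  homeomorphic X Y -> homeomorphic Y Z -> homeomorphic X Z.
Proof.
move=> [f [cf [g [cg fK gK]]]] [f' [cf' [g' [cg' fK' gK']]]].
exists (f' \o f); split.
  by move=> x; apply: continuous_comp; [exact: cf|exact: cf'].
exists (g \o g'); split.
- by move=> x; apply: continuous_comp; [exact: cg'|exact: cg].
- by move=> x /=; rewrite fK' fK.
- by move=> x /=; rewrite gK gK'.
Qed.

Lemma locally_constant_continuous (X Y : topologicalType) (f : X -> Y) :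
  (forall x, \forall y \near x, f y = f x) -> continuous f.
Proof.
move=> fc x W /= Wfx; apply: filterS (fc x) => y /= ->.
exact: nbhs_singleton Wfx.
Qed.

Lemma extremally_disconnected_zero_dimensional (X : topologicalType) :
  hausdorff_space X -> extremally_disconnected X -> zero_dimensional X.
Proof.
rewrite open_hausdorff => hX eX x y /hX[[U V] /= [xU yV] [oU oV /eqP UV]].
exists (closure U); split.
- by split; [exact: eX|exact: closed_closure].
- by apply: subset_closure; exact: set_mem.
- move=> /(_ V)[|z Uz].
    by apply: open_nbhs_nbhs; split => //; exact/set_mem.
  by have : (U `&` V) z by []; rewrite UV.
Qed.

End general_topology.

(** * Representation of an object as functions on its Yosida space *)

Section yosida_topology.
Context (R : realType) (A : wstarType R).

(** If [nu a M < c < nu a N], the positive parts of [c u - a] and [a - c u] are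
    nonzero on disjoint basic open sets around [M] and [N]. *)
Lemma yosida_hausdorff : hausdorff_space (Yosida A).
Proof.
have oset (b : A) : open [set M : Yosida A | nu b M != 0].
  exists [set b]; apply/seteqP; split => M /=.
    by move=> /eqP h /(_ b erefl)/nu_eq0.
  by move=> h; apply/eqP => /nu_eq0 Mb; apply: h => _ ->.
have sep (M N : Yosida A) a : nu a M < nu a N ->
    exists U V : set (Yosida A),
      [/\ open U, open V, U M, V N & U `&` V = set0].
  move=> MN; pose c := (nu a M + nu a N) / 2.
  pose b (x : A) := vjoin x 0.
  have bE x (L : Yosida A) : nu (b x) L = Num.max (nu x L) 0.
    by have h := nu_character L; rewrite (char_join h) (char0 h).
  have dE (L : Yosida A) : nu (a - c *: wunit) L = nu a L - c.
    have h := nu_character L.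
    by rewrite (charB h) (charZ h) (char_unit h) mulr1.
  have dE' (L : Yosida A) : nu (c *: wunit - a) L = c - nu a L.
    have h := nu_character L.
    by rewrite (charB h) (charZ h) (char_unit h) mulr1.
  exists [set L | nu (b (c *: wunit - a)) L != 0].
  exists [set L | nu (b (a - c *: wunit)) L != 0].
  split => //=.
  - by rewrite bE dE' max_l /c; [apply/eqP; lra|lra].
  - by rewrite bE dE max_l /c; [apply/eqP; lra|lra].
  - apply/seteqP; split => // L /= []; rewrite !bE dE dE'.
    have [h|h] := leP (nu a L) c.
      by rewrite [X in _ -> X != 0 -> _]max_r ?eqxx//; lra.
    by rewrite [X in X != 0]max_r ?eqxx//; lra.
rewrite open_hausdorff => M N /eqP/nu_separates[a /eqP].
rewrite neq_lt => /orP[/sep|/sep] [U [V [oU oV UM VN UV]]].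
  by exists (U, V); split => //=; [exact/mem_set..|exact/eqP].
by exists (V, U); split => //=; [exact/mem_set..|rewrite setIC; exact/eqP].
Qed.

End yosida_topology.

Section representation.
Context (R : realType) (A : wstarType R) (X : topologicalType).
Variable psi : A -> X -> R.
Hypothesis psi_char : forall x, character (fun a => psi a x).
Hypothesis psi_continuous : forall a, continuous (psi a).
Hypothesis psi_separates : forall x y, x <> y -> exists a, psi a x <> psi a y.
Hypothesis psi_inj : forall a b, psi a =1 psi b -> a = b.
Hypothesis compactX : compact [set: X].

Let near_gt a x c : c < psi a x -> nbhs x [set y | c < psi a y].
Proof.
move=> cx; have h : nbhs (psi a x) [set r | c < r].
  by apply: open_nbhs_nbhs; split => //; exact: open_gt.
exact: (@psi_continuous a x _ h).
Qed.

(** Otherwise each point of [X] has a neighbourhood on which some positive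
    element of [M] is at least [1]; summing finitely many of these puts an
    element above [u] into [M]. *)
Lemma yosida_point_spatial (M : Yosida A) :
  exists x, forall a, ideal M a -> psi a x = 0.
Proof.
apply: contrapT => noX; have [IM Mu _] := yosidaP M.
have [_ MD MZ _] := IM.
apply: Mu; suff [m [Mm m0 m1]] : exists m : A,
    [/\ ideal M m, 0 <= m & forall x, [set: X] x -> 1 <= psi m x].
  apply: (ideal_squeeze IM wunit_ge0 _ Mm); apply: vjoin_eq_le.
  apply: psi_inj => x; have h := psi_char x.
  by rewrite (char_join h) (char_unit h) max_r// m1.
apply: (compact_set_ind (Q := fun K => exists m : A,
    [/\ ideal M m, 0 <= m & forall x, K x -> 1 <= psi m x])) => //.
- by exists 0; split => //; case: IM.
- by move=> S T ST [m [Mm m0 mT]]; exists m; split => // x /ST/mT.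
- move=> S T [m [Mm m0 mS]] [l [Ml l0 lT]]; exists (m + l).
  have psi_ge0 (a : A) x : 0 <= a -> 0 <= psi a x.
    by move=> /(char_le (psi_char x)); rewrite (char0 (psi_char x)).
  split; [exact: MD|exact: vlat_addr_ge0|move=> x].
  rewrite (charD (psi_char x)) => -[/mS h|/lT h].
    by have := psi_ge0 _ x l0; lra.
  by have := psi_ge0 _ x m0; lra.
- move=> x _.
  have [a Ma /eqP ax] : exists2 a, ideal M a & psi a x <> 0.
    apply: contrapT => h; apply: noX; exists x => a Ma.
    by apply: contrapT => ax; apply: h; exists a.
  pose m := (2 / `|psi a x|) *: vabs a.
  have mx : psi m x = 2.
    rewrite /m (charZ (psi_char x)) (char_abs (psi_char x)) divfK//.
    by rewrite normr_eq0.
  exists [set y | 1 < psi m y]; first by apply: near_gt; rewrite mx; lra.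
  exists m; split; [by apply: MZ; exact/yosida_vabs| |by move=> y /ltW].
  by rewrite vlat_scale_ge0 ?vabs_ge0// divr_ge0.
Qed.

(** The uniqueness of the Yosida space: any compact space on which [A] is
    faithfully represented by continuous functions separating points is a copy
    of it. *)
Theorem representation_homeomorphism :
  homeomorphism (fun x => char_point (psi_char x)).
Proof.
apply: compact_hausdorff_homeomorphism => //.
- exact: yosida_hausdorff.
- apply/continuousP => _ [S ->].
  rewrite (_ : _ @^-1` _ =
    \bigcup_(s in S) psi s @^-1` (~` [set 0])).
    apply: bigcup_open => s _; have /continuousP := @psi_continuous s; apply.
    by apply: closed_openC; exact: closed_eq.
  apply/seteqP; split => x /=.
    by move=> /existsNP[s /not_implyP[Ss h]]; exists s.
  by move=> [s Ss h] /(_ s Ss).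
- move=> x y xy; apply: contrapT => /psi_separates[a]; apply.
  by rewrite -(nu_char_point (psi_char x)) -(nu_char_point (psi_char y)) xy.
- move=> M; have [x Mx] := yosida_point_spatial M; exists x.
  apply: yosida_eq; have [_ _ Mmax] := yosidaP M.
  by have [Ik uk _] := char_kernel_maximal (psi_char x); exact: Mmax.
Qed.

End representation.

(** * Finite-valued functions are generated by separation *)

Section continuous_level_sets.
Context (R : realType) (X : topologicalType) (f : X -> R).

Lemma continuous_open_gt c : continuous f -> open [set x | c < f x].
Proof. by move=> /continuousP/(_ _ (@open_gt _ c)). Qed.

Lemma continuous_open_lt c : continuous f -> open [set x | f x < c].
Proof. by move=> /continuousP/(_ _ (@open_lt _ c)). Qed.

End continuous_level_sets.

Section finite_valued.
Context (R : realType) (B : wstarType R) (Z : topologicalType).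
Variable phi : B -> Z -> R.
Hypothesis phi_char : forall z, character (fun b => phi b z).
Hypothesis phi_continuous : forall b, continuous (phi b).
Hypothesis compactZ : compact [set: Z].

Let phi_unit b c z : phi (b + c *: wunit) z = phi b z + c.
Proof.
have h := phi_char z.
by rewrite (charD h) (charZ h) (char_unit h) mulr1.
Qed.

Let interpolate x y (c d : R) : (exists b, phi b x <> phi b y) ->
  exists b, phi b x = c /\ phi b y = d.
Proof.
move=> [b /eqP bxy]; have xy0 : phi b x - phi b y != 0 by rewrite subr_eq0.
pose e := (c - d) / (phi b x - phi b y).
have ee : e * phi b x - e * phi b y = c - d by rewrite -mulrBr /e divfK.
exists (e *: b + (c - e * phi b x) *: wunit).
rewrite !phi_unit (charZ (phi_char x)) (charZ (phi_char y)).
by split; lra.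
Qed.

(** A twofold compactness argument: first over the complement of [U], taking
    meets with the point [x] of [U] fixed, then over [U], taking joins. *)
Lemma clopen_indicator (U : set Z) : clopen U ->
  (forall x y, U x -> ~ U y -> exists b, phi b x <> phi b y) ->
  exists b, (forall z, U z -> phi b z = 1) /\ (forall z, ~ U z -> phi b z = 0).
Proof.
move=> [oU cU] sepU.
have cst_val c z : phi (c *: wunit) z = c.
  by rewrite (charZ (phi_char z)) (char_unit (phi_char z)) mulr1.
have sep1 x : U x ->
    exists b, 2 <= phi b x /\ (forall y, (~` U) y -> phi b y <= 0).
  move=> Ux; apply: (compact_set_ind (Q := fun K => exists b,
      2 <= phi b x /\ (forall y, K y -> phi b y <= 0))) => //.
  - by apply: subclosed_compact compactZ _ => //; exact: open_closedC.
  - by exists (2 *: wunit); rewrite cst_val.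
  - by move=> S T ST [b [bx bT]]; exists b; split => // y /ST/bT.
  - move=> S T [b [bx bS]] [c [cx cT]]; exists (vmeet b c).
    rewrite (char_meet (phi_char x)) le_min bx cx; split => // y.
    rewrite (char_meet (phi_char y)) ge_min.
    by move=> [/bS|/cT] ->; rewrite ?orbT.
  (* The values 2 and -1 leave room for the strict bounds 1 and 0 nearby. *)
  - move=> y Uy; have [b [bx by_]] := interpolate 2 (-1) (sepU x y Ux Uy).
    exists [set z | phi b z < 0].
      apply: open_nbhs_nbhs; split; last by rewrite /= by_; lra.
      exact/continuous_open_lt/phi_continuous.
    by exists b; rewrite bx; split => // z /ltW.
have [b [b1 b0]] : exists b, (forall x, U x -> 1 <= phi b x) /\
    (forall y, ~ U y -> phi b y <= 0).
  apply: (compact_set_ind (Q := fun K => exists b,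
      (forall x, K x -> 1 <= phi b x) /\ (forall y, ~ U y -> phi b y <= 0))).
  - exact: subclosed_compact compactZ _.
  - by exists (0 *: wunit); split => // y _; rewrite cst_val.
  - by move=> S T ST [b [bT b0]]; exists b; split => // x /ST/bT.
  - move=> S T [b [bS b0]] [c [cT c0]]; exists (vjoin b c); split => x.
      rewrite (char_join (phi_char x)) le_max.
      by move=> [/bS|/cT] ->; rewrite ?orbT.
    by move=> Ux; rewrite (char_join (phi_char x)) ge_max b0// c0.
  - move=> x /sep1[b [bx b0]]; exists [set z | 1 < phi b z].
      apply: open_nbhs_nbhs; split; last by rewrite /=; lra.
      exact/continuous_open_gt/phi_continuous.
    by exists b; split => // z /ltW.
exists (vjoin (vmeet b wunit) 0); split => z Uz;
  rewrite (char_join (phi_char z)) (char_meet (phi_char z));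
  rewrite (char_unit (phi_char z)) (char0 (phi_char z)).
  by rewrite min_r ?max_l// b1.
by rewrite min_l ?max_r ?b0// (le_trans (b0 _ Uz)).
Qed.

(** [k] is the sum of its values times the indicators of its level sets, which
    are clopen; the induction runs over the list of values already treated. *)
Lemma finite_valued_realized (k : Z -> R) :
  continuous k -> finite_set (range k) ->
  (forall x y, k x <> k y -> exists b, phi b x <> phi b y) ->
  exists b, phi b =1 k.
Proof.
move=> ck fk sepk.
have clk r : clopen (k @^-1` [set r]).
  have closedP (F : set R) : finite_set F -> closed (k @^-1` F).
    move=> fF; move/continuous_closedP : ck; apply.
    apply: (iffLR accessible_finite_set_closed) fF.
    exact/hausdorff_accessible/Rhausdorff.
  split; last by apply: closedP; exact: finite_set1.
  rewrite -closedC (_ : ~` _ = k @^-1` (range k `\ r)).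
    apply: closedP; exact: finite_setD.
  by apply/seteqP; split => [z /= kz|z /= []//]; split => //; exists z.
have [s sE] := iffLR (finite_seqP _) fk.
suff h (t : seq R) : exists b, forall z, phi b z = if k z \in t then k z else 0.
  have [b bE] := h s; exists b => z; rewrite bE.
  suff -> : k z \in s by [].
  have : range k (k z) by exists z.
  by rewrite sE.
elim: t => [|r t [b bE]].
  by exists 0 => z; rewrite (char0 (phi_char z)).
have [rt|rt] := boolP (r \in t).
  by exists b => z; rewrite bE in_cons; case: eqP => [->|//]; rewrite rt.
have [x y /= xr yr|c [c1 c0]] := clopen_indicator (clk r).
  by apply: sepk; rewrite xr => /esym.
exists (b + r *: c) => z.
rewrite (charD (phi_char z)) (charZ (phi_char z)) bE in_cons.
have [kr|kr] := eqVneq (k z) r; last by rewrite c0 ?mulr0 ?addr0//; exact/eqP.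
by rewrite c1// kr (negbTE rt) add0r mulr1.
Qed.

End finite_valued.

(** * The lattices [F(X)] *)

Section finite_functions.
Context (R : realType) (X : topologicalType).

Lemma finW_character (x : X) : character (fun k : finW R X => k x).
Proof. by split. Qed.

Lemma finW_indicator (V : set X) : clopen V ->
  exists k : finW R X,
    (forall x, V x -> k x = 1) /\ (forall x, ~ V x -> k x = 0).
Proof.
move=> [oV cV]; have kc : continuous (\1_V : X -> R).
  apply: locally_constant_continuous => x; rewrite /indic.
  have [Vx|Vx] := pselect (V x).
    have : nbhs x V by exact: open_nbhs_nbhs.
    by apply: filterS => y Vy; rewrite !mem_set.
  have : nbhs x (~` V).
    by apply: open_nbhs_nbhs; split => //; exact: closed_openC.
  by apply: filterS => y Vy; rewrite !memNset.
have kf : finite_set (range (\1_V : X -> R)).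
  apply: (@sub_finite_set _ _ [set 0; 1]) => [_ [x _ <-]|]; last first.
    by rewrite finite_setU; split; exact: finite_set1.
  by rewrite /indic; case: (_ \in _); [right|left].
exists (@FinW R X (mkcts kc) kf); split => x Vx.
  by change (\1_V x = 1 :> R); rewrite /indic mem_set.
by change (\1_V x = 0 :> R); rewrite /indic memNset.
Qed.

Lemma finW_representation : compact [set: X] -> zero_dimensional X ->
  homeomorphism (fun x : X => char_point (finW_character x)).
Proof.
move=> cX zX; apply: representation_homeomorphism => //.
- by move=> k; exact: cts_fun.
- move=> x y /eqP/zX[V [cV Vx Vy]].
  have [k [k1 k0]] := finW_indicator cV; exists k; rewrite k1// k0//.
  by apply/eqP; exact: oner_neq0.
- move=> [f fP] [g gP] /= /continuousEP fg; case: _ / fg gP => gP.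
  by congr FinW; exact: Prop_irrelevance.
Qed.

End finite_functions.

Section finite_functions_minimal.
Context (R : realType) (Z : compHausType) (X : topologicalType).
Context (g : continuousType Z X) (B : Wover (contW R Z)) (f : Z -> Yosida B).

(** The hypothesis on open sets is what makes the embedding essential: below a
    nonzero [b >= 0] sits a positive multiple of the indicator of a nonempty
    clopen set. *)
Lemma finW_over_le :
  (forall x, exists z, g z = x) ->
  (forall W, open W -> W !=set0 ->
    exists V, [/\ clopen V, V !=set0 & g @^-1` V `<=` W]) ->
  (forall M, exists z, f z = M) ->
  (forall b z, (Wover_map b : contW R Z) z = nu b (f z)) ->
  (forall x y, f x = f y -> g x = g y) ->
  Wover_le (finW_over R g) B.
Proof.
move=> gsurj girr fsurj mapE fg.
pose phi (b : B) z := (Wover_map b : contW R Z) z.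
have phi_char z : character (fun b => phi b z).
  have -> : (fun b => phi b z) = (fun b => nu b (f z)).
    by apply/funext => b; exact: mapE.
  exact: nu_character.
have phi_cont b : continuous (phi b) by move=> z; exact: cts_fun.
have phi_inj a b : phi a =1 phi b -> a = b.
  move=> ab; apply: nu_inj => M; have [z <-] := fsurj M.
  by rewrite -!mapE; exact: ab.
have phi_le a b : (forall z, phi a z <= phi b z) -> a <= b.
  move=> ab; apply: nu_le => M; have [z <-] := fsurj M.
  by rewrite -!mapE; exact: ab.
have real (k : finW R X) : exists b, phi b =1 k \o g.
  apply: (finite_valued_realized phi_char phi_cont ch_compact).
  - by move=> z; apply: continuous_comp; exact: cts_fun.
  - apply: (sub_finite_set _ (finW_finite k)) => _ [z _ <-].
    by exists (g z).
  - move=> x y kxy; have [|b bxy] := @nu_separates _ _ (f x) (f y).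
      by move=> /fg gxy; apply: kxy; rewrite /= gxy.
    by exists b; rewrite /phi !mapE.
pose j k := sval (cid (real k)).
have jE k z : phi (j k) z = k (g z) := svalP (cid (real k)) z.
have jc := fun z => phi_char z.
exists j; last first.
  by move=> k; apply/continuousEP => z; rewrite -/(phi _ _) jE.
split.
- split.
  + move=> c a b; apply: phi_inj => z.
    by rewrite jE (charD (jc z)) (charZ (jc z)) !jE.
  + by move=> a b; apply: phi_inj => z; rewrite (char_join (jc z)) !jE.
  + by move=> a b; apply: phi_inj => z; rewrite (char_meet (jc z)) !jE.
  + by apply: phi_inj => z; rewrite (char_unit (jc z)) jE.
- move=> a b jab.
  have ab : (a : X -> R) =1 b.
    by move=> x; have [z <-] := gsurj x; rewrite -!jE jab.
  case: a b {jab} ab => [a aP] [b bP] /= /continuousEP ab.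
  by case: _ / ab bP => bP; congr FinW; exact: Prop_irrelevance.
- move=> b b0; have pb0 z : 0 <= phi b z.
    by have := char_le (jc z) (ltW b0); rewrite (char0 (jc z)).
  have [z0 bz0] : exists z0, 0 < phi b z0.
    apply: contrapT => h; have : b <= 0.
      apply: phi_le => z; rewrite (char0 (jc z)) leNgt; apply/negP => bz.
      by apply: h; exists z.
    by move=> /(lt_le_trans b0); rewrite ltxx.
  pose d := phi b z0 / 2; have d0 : 0 < d by rewrite divr_gt0.
  have [||V [cV [x0 Vx0] VW]] := girr [set z | d < phi b z].
  + by apply: continuous_open_gt; exact: phi_cont.
  + by exists z0; rewrite /= /d; lra.
  have [k [k1 k0]] := finW_indicator R cV.
  exists k, (Num.bound d^-1); split.
    rewrite lt_neqAle; apply/andP; split.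
      apply/eqP => /(congr1 (fun h : finW R X => h x0)) /=.
      by rewrite k1// => /esym/eqP; rewrite oner_eq0.
    apply/asboolP => x; rewrite [leLHS]/(0 : R).
    by have [/k1|/k0] := pselect (V x); move=> /= ->.
  apply: phi_le => z.
  have phin (n : nat) : phi (b *+ n) z = n%:R * phi b z.
    by rewrite -scaler_nat (charZ (jc z)).
  rewrite jE phin; have [Vz|Vz] := pselect (V (g z)); last first.
    by rewrite k0// mulr_ge0.
  rewrite k1//; have /= dz := VW z Vz.
  have nd : d^-1 < (Num.bound d^-1)%:R.
    by apply: archi_boundP; rewrite invr_ge0 ltW.
  rewrite -[leLHS](mulVf (lt0r_neq0 d0)).
  by apply: ler_pM; rewrite ?invr_ge0; exact: ltW.
Qed.

End finite_functions_minimal.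

(** * The quotient identifying two points *)

Section identified_pair.
Local Open Scope quotient_scope.
Context (E : compHausType) (p q : E).
Local Notation gam := (@gamma E p q).

Lemma gamma_surjective (y : Edot p q) : exists x, gam x = y.
Proof. by exists (repr y); exact: reprK. Qed.

Lemma gamma_eq (x y : E) :
  gam x = gam y <-> x = y \/ (x \in [:: p; q]) /\ (y \in [:: p; q]).
Proof.
split=> [/eqquotP/predU1P[|/andP[]]|[->//|[xpq ypq]]]; [by left|by right|].
by apply/eqquotP/predU1P; right; apply/andP.
Qed.

Lemma compact_Edot : compact [set: Edot p q].
Proof.
have -> : [set: Edot p q] = gam @` setT.
  by apply/seteqP; split => // y _; have [x <-] := gamma_surjective y; exists x.
apply: continuous_compact; last exact: ch_compact.
by apply: continuous_subspaceT; exact: gamma_continuous.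
Qed.

Lemma saturated_clopen (U : set E) : clopen U -> (U p <-> U q) ->
  exists V : set (Edot p q), clopen V /\ gam @^-1` V = U.
Proof.
move=> [oU cU] Upq; exists (gam @` U).
have preU : gam @^-1` (gam @` U) = U.
  apply/seteqP; split => [x [y Uy /gamma_eq]|x Ux]; last by exists x.
  case=> [<-//|[]]; rewrite !inE => /orP[] /eqP yE /orP[] /eqP ->;
    move: Uy; rewrite yE; tauto.
split => //; split.
  by move: oU; rewrite -[X in open X -> _]preU.
rewrite -openC; have := closed_openC cU.
by rewrite -[in X in X -> _]preU preimage_setC.
Qed.

Lemma zero_dimensional_avoid (X : topologicalType) (x : X) (s : seq X) :
  zero_dimensional X -> x \notin s ->
  exists V, [/\ clopen V, V x & forall y, y \in s -> ~ V y].
Proof.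
move=> zX; elim: s => [_|a s ih].
  by exists setT; split => //; exact: clopenT.
rewrite in_cons negb_or => /andP[/zX[U [cU Ux Ua]] /ih[V [cV Vx Vs]]].
exists (U `&` V); split => //; first exact: clopenI.
by move=> y; rewrite in_cons => /predU1P[-> []//|/Vs nV []].
Qed.

(** A clopen set of [E] separating [x] from [y] descends to the quotient once
    it contains both of [p] and [q] or neither; if [x] is one of them, the
    complement of a small clopen neighbourhood of [y] will do. *)
Lemma zero_dimensional_Edot : zero_dimensional E -> zero_dimensional (Edot p q).
Proof.
move=> zE xd yd; have [x <-] := gamma_surjective xd.
have [y <-] := gamma_surjective yd => /eqP xy.
suff [U [cU Upq Ux Uy]] : exists U, [/\ clopen U, U p <-> U q, U x & ~ U y].
  have [V [cV VU]] := saturated_clopen cU Upq.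
  by exists V; rewrite -VU in Ux Uy.
have nxy : x <> y by move=> h; apply: xy; rewrite h.
have [xpq|xpq] := boolP (x \in [:: p; q]); last first.
  have [|V [cV Vx Vs]] := @zero_dimensional_avoid _ x [:: y; p; q] zE.
    by rewrite in_cons negb_or xpq andbT; exact/eqP.
  exists V; split => //; last by apply: Vs; rewrite inE eqxx.
  by split=> h; exfalso; apply: (Vs _ _ h); rewrite !inE eqxx ?orbT.
have ypq : y \notin [:: p; q].
  by apply/negP => ypq; apply: xy; apply/gamma_eq; right.
have [V [cV Vy Vs]] := zero_dimensional_avoid zE ypq.
exists (~` V); split.
- exact: clopenC.
- by split=> _; apply: Vs; rewrite !inE eqxx ?orbT.
- exact: Vs.
- by move/(_ Vy).
Qed.

(** A nonempty open set cannot be contained in [{p, q}], since then [p] or [q]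
    would be isolated. *)
Lemma gamma_irreducible : zero_dimensional E ->
  ~ isolated [set: E] p -> ~ isolated [set: E] q ->
  forall W, open W -> W !=set0 -> exists V : set (Edot p q),
    [/\ clopen V, V !=set0 & gam @^-1` V `<=` W].
Proof.
move=> zE ip iq W oW [w Ww].
have clos1 (x : E) : closed [set x].
  exact/accessible_closed_set1/hausdorff_accessible/ch_hausdorff.
have other (a : E) (S : set E) : ~ isolated [set: E] a ->
    open S -> S a -> exists2 z, S z & z <> a.
  move=> ia oS Sa; apply: contrapT => h; apply: ia; split; first by rewrite inE.
  exists S; first exact: open_nbhs_nbhs.
  apply/seteqP; split => [z [Sz _]|_ ->//].
  by apply: contrapT => za; apply: h; exists z.
have [z1 Wz1 z1p] : exists2 z, W z & z <> p.
  have [wp|wp] := pselect (w = p); last by exists w.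
  by apply: other => //; rewrite -wp.
have [z Wz [zp zq]] : exists2 z, W z & z <> p /\ z <> q.
  have [zq|zq] := pselect (z1 = q); last by exists z1.
  have oS : open (W `&` ~` [set p]) by apply: openI => //; exact/closed_openC.
  have [|z [Wz zp] zq'] := other q _ iq oS; first by rewrite -zq.
  by exists z.
have /(iffLR (zero_dimensional_clopen_base E)) base := zE.
have [|U [cU Uz US]] := base z (W `&` (~` [set p] `&` ~` [set q])).
  apply: open_nbhs_nbhs; split => //.
  by apply: openI => //; apply: openI; apply: closed_openC.
have [|V [cV VU]] := saturated_clopen cU.
  by split=> /US[_ [np nq]]; [case: np|case: nq].
exists V; split => //; last by rewrite VU => x /US[].
by exists (gam z); have : U z by []; rewrite -VU.
Qed.

End identified_pair.

(** * Functions constant near a given point *)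

Record locW (R : realType) (X : topologicalType) (x0 : X) := LocW {
  locW_fun :> continuousType X R ;
  locW_const : \forall x \near x0, locW_fun x = locW_fun x0 }.

Section L_wstar.
Context (R : realType) (X : compHausType) (x0 : X).

HB.instance Definition _ := gen_eqMixin (locW R x0).
HB.instance Definition _ := gen_choiceMixin (locW R x0).

Let L_inj (f g : locW R x0) : (f : X -> R) =1 g -> f = g.
Proof.
case: f g => [f fP] [g gP] /= /continuousEP fg; case: _ / fg gP => gP.
by congr LocW; exact: Prop_irrelevance.
Qed.

Let cst_loc (c : R) : \forall x \near x0, (cst c : X -> R) x = cst c x0.
Proof. exact: nearW. Qed.

Let loc2 (h : R -> R -> R) (f g : locW R x0) :
  \forall x \near x0, h (f x) (g x) = h (f x0) (g x0).
Proof. by apply: filterS2 (locW_const f) (locW_const g) => x -> ->. Qed.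

Let L_bounded (f : locW R x0) : exists M : R, forall x, f x <= M.
Proof.
apply: compact_range_bounded; apply: continuous_compact; last exact: ch_compact.
by apply: continuous_subspaceT; exact: cts_fun.
Qed.

Let L_one : locW R x0 := @LocW R X x0 (cst 1) (cst_loc 1).
Let L_zero : locW R x0 := @LocW R X x0 (cst 0) (cst_loc 0).
Let L_opp (f : locW R x0) : locW R x0 :=
  @LocW R X x0 (mkcts (@cont_opp R X f)) (loc2 (fun a _ => - a) f f).
Let L_add (f g : locW R x0) : locW R x0 :=
  @LocW R X x0 (mkcts (@cont_add R X f g)) (loc2 +%R f g).
Let L_scale (c : R) (f : locW R x0) : locW R x0 :=
  @LocW R X x0 (mkcts (@cont_scale R X c f)) (loc2 (fun a _ => c * a) f f).
Let L_max (f g : locW R x0) : locW R x0 :=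
  @LocW R X x0 (mkcts (@cont_max R X f g)) (loc2 Num.max f g).
Let L_min (f g : locW R x0) : locW R x0 :=
  @LocW R X x0 (mkcts (@cont_min R X f g)) (loc2 Num.min f g).
Let L_oneE x : L_one x = 1. Proof. by []. Qed.
Let L_zeroE x : L_zero x = 0. Proof. by []. Qed.
Let L_oppE f x : L_opp f x = - f x. Proof. by []. Qed.
Let L_addE f g x : L_add f g x = f x + g x. Proof. by []. Qed.
Let L_scaleE c f x : L_scale c f x = c * f x. Proof. by []. Qed.
Let L_maxE f g x : L_max f g x = Num.max (f x) (g x). Proof. by []. Qed.
Let L_minE f g x : L_min f g x = Num.min (f x) (g x). Proof. by []. Qed.

HB.instance Definition _ := FunLattice_isWstar.Build R (locW R x0) L_inj
  L_oneE L_zeroE L_oppE L_addE L_scaleE L_maxE L_minE L_bounded.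

Lemma locW_character (x : X) : character (fun k : locW R x0 => k x).
Proof. by split. Qed.

(** Of two distinct points one is not [x0], say [x]; a Urysohn function that is
    [1] at [x] and vanishes at the other point and near [x0] separates them. *)
Lemma locW_separates (x y : X) : x <> y -> exists k : locW R x0, k x <> k y.
Proof.
wlog xx0 : x y / x <> x0.
  move=> h xy; have [xx0|xx0] := pselect (x = x0); last exact: h.
  have [||k kyx] := h y x; [by rewrite -xx0 => /esym|by move/esym|].
  by exists k => /esym.
move=> xy; have hX := @ch_hausdorff X.
have clos1 (z : X) : closed [set z].
  exact/accessible_closed_set1/hausdorff_accessible.
move: (hX); rewrite open_hausdorff => /(_ x x0)/(_ _)[|[U V] /= [xU x0V]].
  exact/eqP.
move=> [oU oV /eqP UV]; pose C := ~` U `|` [set y].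
have cC : closed C by apply: closedU => //; exact: open_closedC.
have normalX : normal_space X by apply: compact_normal => //; exact: ch_compact.
have Cx0 : C `&` [set x] = set0.
  apply/seteqP; split => // z [Cz zx]; move: zx Cz => ->.
  by case=> [h|h]; [apply: h; exact: set_mem|exact: xy].
have /(@uniform_separatorP _ R)[f [cf _ f0 f1]] :=
  normal_uniform_separator normalX cC (clos1 x) Cx0.
have f0C z : C z -> f z = 0 by move=> Cz; apply: f0; exists z.
have nU z : V z -> C z.
  by move=> Vz; left => Uz; have : (U `&` V) z by []; rewrite UV.
have Vx0 : V x0 by exact: set_mem.
have floc : \forall z \near x0, (mkcts cf : X -> R) z = mkcts cf x0.
  have : nbhs x0 V by exact: open_nbhs_nbhs.
  apply: filterS => z Vz; change (f z = f x0).
  by rewrite !f0C//; exact: nU.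
exists (LocW floc); change (f x <> f y).
have -> : f x = 1 by apply: f1; exists x.
by rewrite f0C; [apply/eqP/oner_neq0|right].
Qed.

Lemma locW_representation :
  homeomorphism (fun x : X => char_point (locW_character x)).
Proof.
apply: representation_homeomorphism.
- by move=> k; exact: cts_fun.
- exact: locW_separates.
- exact: L_inj.
- exact: ch_compact.
Qed.

Definition locW_over : Wover (contW R X) :=
  @MkWover R (contW R X) (locW R x0) (fun k => k : continuousType X R).

End L_wstar.

(** * Minima of the classes *)

Section classes.
Context (R : realType) (E : compHausType) (p q : E).

(** The cover over [E] may arise from [gamma] or from a homeomorphism onto [E];
    in both cases it separates whatever [gamma] separates. The equation between
    [Z] and [E] keeps the space variable for the case analysis, and is used at
    [erefl]. *)
Lemma a_gamma_cover (X Z : topologicalType) (f : Z -> X) : a_gamma p q f ->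
  (forall x, exists z, f z = x) /\
  (forall (e : Z = E :> topologicalType) x y, f x = f y ->
    gamma p q (eq_rect Z (fun T : topologicalType => T) x E e)
      = gamma p q (eq_rect Z (fun T : topologicalType => T) y E e)).
Proof.
case=> {Z f} [h|Z f _].
  move=> [_ [k [_ hK kK]]]; split=> [x|e x y /= hxy].
    by have [z zk] := gamma_surjective (k x); exists z; rewrite /= zk.
  rewrite (Prop_irrelevance e erefl) /=.
  exact: (can_inj hK).
move=> [_ [k [_ fK kK]]]; split=> [x|e x y /(can_inj fK) ->//].
by exists (k x).
Qed.

Lemma a_gamma_homeomorphism (X Z : topologicalType) (f : Z -> X) :
  a_gamma p q f -> ~ homeomorphic Z E -> homeomorphism f.
Proof.
case=> [h _ []|//]; exists idfun; split; first by move=> x.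
by exists idfun; split => // x.
Qed.

Lemma finW_gamma_minimum : extremally_disconnected E ->
  ~ isolated [set: E] p -> ~ isolated [set: E] q ->
  is_minimum (@Vclass R (a_gamma p q) E) (finW_over R (gamma p q)).
Proof.
move=> eE ip iq.
have zE := extremally_disconnected_zero_dimensional (@ch_hausdorff E) eE.
split.
  have hom := finW_representation R (@compact_Edot E p q)
    (@zero_dimensional_Edot E p q zE).
  exists ((fun x => char_point (finW_character R x)) \o gamma p q).
    exact: a_gamma_Edot.
  by move=> k z /=; rewrite nu_char_point.
move=> B [f /a_gamma_cover[fsurj /(_ erefl) fg] mapE].
apply: (finW_over_le _ _ fsurj mapE fg); first exact: gamma_surjective.
exact: gamma_irreducible.
Qed.

Section other_space.
Context (Y : compHausType).
Hypothesis YEdot : ~ homeomorphic Y (Edot p q).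
Hypothesis YE : ~ homeomorphic Y E.

Lemma Vclass_homeomorphism (A : Wover (contW R Y)) (f : Y -> Yosida A) :
  homeomorphism f ->
  (forall a z, (Wover_map a : contW R Y) z = nu a (f z)) ->
  Vclass (a_gamma p q) A.
Proof.
move=> hf mapE; exists f => //; apply: a_gamma_id => // h; apply: YEdot.
by apply: homeomorphism_trans h; exists f.
Qed.

Lemma finW_id_minimum : zero_dimensional Y ->
  is_minimum (@Vclass R (a_gamma p q) Y) (finW_over R (@idfun Y)).
Proof.
move=> zY; split.
  have hom := finW_representation R (@ch_compact Y) zY.
  apply: (@Vclass_homeomorphism (finW_over R (@idfun Y)) _ hom) => a z.
  by rewrite nu_char_point.
move=> B [f /a_gamma_homeomorphism/(_ YE)[_ [k [_ fK kK]]] mapE].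
apply: (@finW_over_le R Y Y _ _ f _ _ _ mapE).
- by move=> x; exists x.
- move=> W oW [w Ww].
  have [|V [cV Vw VW]] := iffLR (zero_dimensional_clopen_base Y) zY w W.
    exact: open_nbhs_nbhs.
  by exists V; split => //; exists w.
- by move=> M; exists (k M); exact: kK.
- by move=> x y /(can_inj fK).
Qed.

(** Comparing the minimum with [locW_over R x0] for every [x0] shows that its
    elements are locally constant. *)
Lemma minimum_zero_dimensional (A : Wover (contW R Y)) :
  is_minimum (@Vclass R (a_gamma p q) Y) A -> zero_dimensional Y.
Proof.
move=> [[f /a_gamma_homeomorphism/(_ YE)[_ [k [_ fK kK]]] mapE] Amin].
have loc (a : A) (x0 : Y) : \forall x \near x0,
    (Wover_map a : contW R Y) x = (Wover_map a : contW R Y) x0.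
  have [|j _ jE] := Amin (locW_over R x0).
    by apply: (@Vclass_homeomorphism (locW_over R x0) _
      (locW_representation R x0)) => b z;
      rewrite nu_char_point.
  by rewrite jE; exact: locW_const.
move=> x y /eqP xy.
have [a ha] : exists a, nu a (f x) <> nu a (f y).
  by apply: nu_separates => /(can_inj fK).
exists [set z | (Wover_map a : contW R Y) z = (Wover_map a : contW R Y) x].
split => //; last by rewrite /= !mapE => /esym.
split.
  rewrite openE => z /= zx; have := loc a z.
  by apply: filterS => w wz; rewrite /= wz.
rewrite -openC openE => z /= zx; have := loc a z.
by apply: filterS => w wz wx; apply: zx; rewrite -wz.
Qed.

End other_space.
End classes.

Theorem theorem7p8 (R : realType) (E : compHausType) (p q : E) :
  extremally_disconnected E ->
  infinite_set [set: E] ->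
  p <> q ->
  ~ isolated [set: E] p ->
  ~ isolated [set: E] q ->
  is_minimum (@Vclass R (a_gamma p q) E) (finW_over R (gamma p q))
  /\
  (forall Y : compHausType,
     ~ homeomorphic Y (Edot p q) ->
     ~ homeomorphic Y E ->
     ((exists A : Wover (contW R Y), is_minimum (@Vclass R (a_gamma p q) Y) A)
        <-> zero_dimensional Y)
     /\
     (zero_dimensional Y ->
        is_minimum (@Vclass R (a_gamma p q) Y) (finW_over R (@idfun Y)))).
Proof.
move=> eE _ _ ip iq; split; first exact: finW_gamma_minimum.
move=> Y YEdot YE; split; last exact: finW_id_minimum.
split=> [[A]|zY]; first exact: minimum_zero_dimensional.
by exists (finW_over R (@idfun Y)); exact: finW_id_minimum.
Qed.
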